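(* Let $d\ge 2$ be an integer, let $\|\cdot\|$ be any norm on $\mathbb{C}^{d}$ (with the induced operator norm on $d\times d$ matrices also denoted $\|\cdot\|$), and let $\mathscr{A}$ be a non-empty bounded set of complex $d\times d$ matrices whose joint spectral radius satisfies $\rho(\mathscr{A})\neq 0$ (equivalently, $\mathscr{A}^{d}\neq\{0\}$). Let $r$ denote the number of matrices in $\mathscr{A}$, where $r>1$ includes the case that $\mathscr{A}$ is infinite. Then for every integer $n\ge 1$, $$ C_{d}^{-\sigma_{d}(n)/n}\left(\frac{\|\mathscr{A}\|^{d}}{\|\mathscr{A}^{d}\|}\right)^{-\nu_{d}(n)/n}\|\mathscr{A}^{n}\|^{1/n}\;\le\;\rho(\mathscr{A})\;\le\;\|\mathscr{A}^{n}\|^{1/n}, $$ where $$ C_{d}=\begin{cases}2^{d}-1 & \text{if } r=1,\\ d^{3d/2} & \text{if } r>1,\end{cases} $$ $$ \sigma_{d}(n)=\begin{cases}\dfrac12\left(\dfrac{\ln n}{\ln 2}+1\right)\left(\dfrac{\ln n}{\ln 2}+2\right) & \text{if } d=2,\\[2mm] \dfrac{(d-1)^{3}}{(d-2)^{2}}\, n^{\frac{\ln(d-1)}{\ln d}} & \text{if } d>2,\end{cases} $$ $$ \nu_{d}(n)=\begin{cases}\dfrac{\ln n}{\ln 2}+1 & \text{if } d=2,\\[2mm] \dfrac{(d-1)^{2}}{d-2}\, n^{\frac{\ln(d-1)}{\ln d}} & \text{if } d>2.\end{cases} $$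
   Context: For a non-empty bounded set $\mathscr{A}$ of complex $d\times d$ matrices and $n\ge 1$, $\mathscr{A}^{n}=\{A_{n}\cdots A_{2}A_{1} : A_{i}\in\mathscr{A}\}$ denotes the set of all products of $n$ matrices from $\mathscr{A}$ (repetitions allowed), and $$\|\mathscr{A}^{n}\|=\sup_{A\in\mathscr{A}^{n}}\|A\|=\sup_{A_{i}\in\mathscr{A}}\|A_{n}\cdots A_{2}A_{1}\|,$$ where the matrix norm is the operator norm induced by the given norm on $\mathbb{C}^{d}$; in particular $\|\mathscr{A}\|=\|\mathscr{A}^{1}\|$. The joint spectral radius of $\mathscr{A}$ is $$\rho(\mathscr{A})=\lim_{n\to\infty}\|\mathscr{A}^{n}\|^{1/n}=\inf_{n\ge 1}\|\mathscr{A}^{n}\|^{1/n};$$ the limit always exists, equals the infimum, and does not depend on the choice of norm. For a singleton $\mathscr{A}=\{A\}$ it is the usual spectral radius of $A$. *)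

(* Defs.v *)
From mathcomp Require Import all_boot all_order all_algebra.
From mathcomp Require Import all_classical all_reals all_analysis.
From mathcomp Require Import complex.

Set Implicit Arguments.
Unset Strict Implicit.
Unset Printing Implicit Defensive.

Import Order.TTheory GRing.Theory Num.Theory.

Local Open Scope classical_set_scope.
Local Open Scope ring_scope.

(* Norms are passed as functions because column vectors already carry the
   canonical max norm of the library. *)
Record is_norm (R : realType) (d : nat) (N : 'cV[R[i]]_d -> R) : Prop := IsNorm {
  is_norm_ge0 : forall v, 0 <= N v ;
  is_norm_eq0 : forall v, N v = 0 -> v = 0 ;
  is_normZ : forall (a : R[i]) v, N (a *: v) = ComplexField.Normc.normc a * N v ;
  is_norm_triangle : forall u v, N (u + v) <= N u + N v
}.

Definition opnorm (R : realType) (d : nat) (N : 'cV[R[i]]_d -> R)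
    (A : 'M[R[i]]_d) : R :=
  sup [set N (A *m v) | v in [set v : 'cV[R[i]]_d | N v <= 1]].

Definition mxbounded (R : realType) (d : nat) (N : 'cV[R[i]]_d -> R)
    (AA : set 'M[R[i]]_d) : Prop :=
  has_ubound [set opnorm N A | A in AA].

Fixpoint mxprods (R : realType) (d : nat) (AA : set 'M[R[i]]_d) (n : nat)
    : set 'M[R[i]]_d :=
  if n is m.+1 then [set A *m B | A in AA & B in mxprods AA m]
  else [set 1%:M].

Definition setnorm (R : realType) (d : nat) (N : 'cV[R[i]]_d -> R)
    (AA : set 'M[R[i]]_d) : R :=
  sup [set opnorm N A | A in AA].

(* For a bounded AA the sequence converges, so that limn is its actual limit;
   its term of index 0 is immaterial. *)
Definition jsr (R : realType) (d : nat) (N : 'cV[R[i]]_d -> R)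
    (AA : set 'M[R[i]]_d) : R :=
  limn (fun n => setnorm N (mxprods AA n) `^ n%:R^-1).

(* For a nonempty AA, the second branch covers two or more, possibly
   infinitely many, matrices. *)
Definition C_const (R : realType) (d : nat) (AA : set 'M[R[i]]_d) : R :=
  if (AA #= `I_1)%card then 2 ^+ d - 1 else d%:R `^ (3 * d%:R / 2).

Definition sigma (R : realType) (d n : nat) : R :=
  if d == 2%N then
    2^-1 * (ln n%:R / ln 2 + 1) * (ln n%:R / ln 2 + 2)
  else
    (d%:R - 1) ^+ 3 / (d%:R - 2) ^+ 2 * n%:R `^ (ln (d%:R - 1) / ln d%:R).

Definition nu (R : realType) (d n : nat) : R :=
  if d == 2%N then
    ln n%:R / ln 2 + 1
  else
    (d%:R - 1) ^+ 2 / (d%:R - 2) * n%:R `^ (ln (d%:R - 1) / ln d%:R).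

(* Main.v *)
(* With u n = ||A^n|| and L n = ln (u n / rho^n), the function L is subadditive
   and Bochi's inequality ||A^d|| <= C ||A||^(d-1) rho, applied to A^m, reads
   L (d m) <= ln C + (d-1) L m.  Writing n in base d by Horner's scheme bounds
   L n by L 1, and L 1 <= ln C + ln (||A||^d / ||A^d||) by the same inequality.

   For one matrix, Bochi's inequality follows from Cayley-Hamilton with the
   characteristic polynomial factored.  In general take r > rho and a norm M
   with M (A v) <= r (M v) for all matrices A of the set.  Nearly maximal
   ellipsoids (John) replace the given norm and M by Euclidean norms up to
   nearly sqrt d; diagonalize one with respect to the other, with weights D, and
   split each matrix into the entries (i, j) with D j <= D i, which are
   controlled by r, and the others, which form a strictly triangular matrix up
   to a permutation of the basis, so that d such factors multiply to zero. *)
Require Import Defs.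
From mathcomp Require Import all_boot all_order all_algebra.
From mathcomp Require Import all_classical all_reals all_analysis.
From mathcomp Require Import perm complex ring lra zify spectral.

Set Implicit Arguments.
Unset Strict Implicit.
Unset Printing Implicit Defensive.

Import Order.TTheory GRing.Theory Num.Theory.
Import numFieldNormedType.Exports.

Local Open Scope classical_set_scope.
Local Open Scope ring_scope.

Local Notation nc := ComplexField.Normc.normc.
Local Arguments ComplexField.Normc.normc : simpl never.

(** * The modulus of a complex number as a real number *)

Section ComplexModulus.
Variable R : realType.
Implicit Types z w : R[i].

Lemma nc_ge0 z : 0 <= nc z.
Proof. by case: z => a b; rewrite sqrtr_ge0. Qed.

Lemma nc0 : nc (0 : R[i]) = 0.
Proof. exact: ComplexField.Normc.normc0. Qed.

Lemma nc1 : nc (1 : R[i]) = 1.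
Proof. exact: ComplexField.Normc.normc1. Qed.

Lemma ncM z w : nc (z * w) = nc z * nc w.
Proof. exact: ComplexField.Normc.normcM. Qed.

Lemma ncX z k : nc (z ^+ k) = nc z ^+ k.
Proof.
elim: k => [|k IH]; first by rewrite !expr0 nc1.
by rewrite !exprS ncM IH.
Qed.

Lemma ncD z w : nc (z + w) <= nc z + nc w.
Proof. exact: le_normcD. Qed.

Lemma ncN z : nc (- z) = nc z.
Proof. exact: normcN. Qed.

Lemma nc_real (x : R) : nc x%:C%C = `|x|.
Proof. by rewrite /ComplexField.Normc.normc /= expr0n /= addr0 sqrtr_sqr. Qed.

Lemma nc_nneg (x : R) : 0 <= x -> nc x%:C%C = x.
Proof. by move=> x0; rewrite nc_real ger0_norm. Qed.

Lemma nc_sum (I : Type) (r : seq I) (P : pred I) (F : I -> R[i]) :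
  nc (\sum_(i <- r | P i) F i) <= \sum_(i <- r | P i) nc (F i).
Proof.
elim/big_ind2: _ => //; first by rewrite nc0.
by move=> x a y b xa yb; apply: le_trans (ncD _ _) (lerD xa yb).
Qed.

Lemma sqr_nc z : ((nc z ^+ 2)%:C)%C = z^* * z.
Proof.
case: z => a b; rewrite /ComplexField.Normc.normc sqr_sqrtr ?addr_ge0 ?sqr_ge0//.
by apply/eqP; rewrite eq_complex /=; apply/andP; split; apply/eqP; ring.
Qed.

End ComplexModulus.

(** * Euclidean norm, Hermitian inner product and Frobenius norm *)

Lemma CauchySchwarz_sum (R : realType) (I : finType) (a b : I -> R) :
  (\sum_i a i * b i) ^+ 2 <= (\sum_i a i ^+ 2) * (\sum_i b i ^+ 2).
Proof.
(* Lagrange's identity: this sum of squares is twice the gap in the inequality. *)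
have H : 0 <= \sum_i \sum_j (a i * b j - a j * b i) ^+ 2.
  by do 2! apply: sumr_ge0 => ? _; exact: sqr_ge0.
suff E : \sum_i \sum_j (a i * b j - a j * b i) ^+ 2 =
    ((\sum_i a i ^+ 2) * (\sum_i b i ^+ 2) - (\sum_i a i * b i) ^+ 2) *+ 2.
  by move: H; rewrite E pmulrn_lge0// subr_ge0.
transitivity (\sum_i \sum_j (a i ^+ 2 * b j ^+ 2 + b i ^+ 2 * a j ^+ 2
    - (a i * b i * (a j * b j)) *+ 2)).
  by apply: eq_bigr => i _; apply: eq_bigr => j _; ring.
under eq_bigr do rewrite sumrB big_split /= sumrMnl -!mulr_sumr.
rewrite sumrB big_split /= sumrMnl -!mulr_suml.
by rewrite expr2 mulrnBl [X in _ + X - _]mulrC mulr2n.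
Qed.

Section Euclidean.
Variables (R : realType).
Implicit Types d : nat.

Definition sqn d (v : 'cV[R[i]]_d) : R := \sum_i nc (v i 0) ^+ 2.

Definition enorm d (v : 'cV[R[i]]_d) : R := Num.sqrt (sqn v).

Definition hdot d (u v : 'cV[R[i]]_d) : R[i] := \sum_i (u i 0)^* * v i 0.

(** The squared Frobenius norm, whose square root bounds the Euclidean operator norm. *)
Definition fro2 d (A : 'M[R[i]]_d) : R := \sum_i \sum_j nc (A i j) ^+ 2.

Lemma sqn_ge0 d (v : 'cV[R[i]]_d) : 0 <= sqn v.
Proof. by apply: sumr_ge0 => i _; exact: sqr_ge0. Qed.

Lemma fro2_ge0 d (A : 'M[R[i]]_d) : 0 <= fro2 A.
Proof. by do 2! apply: sumr_ge0 => ? _; exact: sqr_ge0. Qed.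

Lemma enorm_ge0 d (v : 'cV[R[i]]_d) : 0 <= enorm v.
Proof. exact: sqrtr_ge0. Qed.

Lemma sqr_enorm d (v : 'cV[R[i]]_d) : enorm v ^+ 2 = sqn v.
Proof. by rewrite sqr_sqrtr// sqn_ge0. Qed.

Lemma sqnE d (v : 'cV[R[i]]_d) : (sqn v)%:C%C = hdot v v.
Proof. by rewrite rmorph_sum /=; apply: eq_bigr => i _; exact: sqr_nc. Qed.

Lemma hdotC d (u v : 'cV[R[i]]_d) : hdot u v = (hdot v u)^*.
Proof.
rewrite /hdot rmorph_sum; apply: eq_bigr => i _.
by rewrite rmorphM /= conjCK mulrC.
Qed.

Lemma hdotDr d (u v w : 'cV[R[i]]_d) : hdot u (v + w) = hdot u v + hdot u w.
Proof.
by rewrite -big_split; apply: eq_bigr => i _; rewrite /= mxE mulrDr.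
Qed.

Lemma hdotZr d (a : R[i]) (u v : 'cV[R[i]]_d) : hdot u (a *: v) = a * hdot u v.
Proof. by rewrite mulr_sumr; apply: eq_bigr => i _; rewrite mxE mulrCA. Qed.

Lemma hdotDl d (u v w : 'cV[R[i]]_d) : hdot (u + v) w = hdot u w + hdot v w.
Proof. by rewrite hdotC hdotDr rmorphD /= -!hdotC. Qed.

Lemma hdotE d (u v : 'cV[R[i]]_d) : hdot u v = (map_mx Num.conj u^T *m v) 0 0.
Proof. by rewrite mxE; apply: eq_bigr => i _; rewrite !mxE. Qed.

Lemma sqnD_orth d (u v : 'cV[R[i]]_d) : hdot u v = 0 -> sqn (u + v) = sqn u + sqn v.
Proof.
move=> uv; apply: complexI; rewrite rmorphD /= !sqnE hdotDr !hdotDl uv.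
by rewrite (hdotC v u) uv rmorph0 addr0 add0r.
Qed.

Lemma sqnZ d (a : R[i]) (v : 'cV[R[i]]_d) : sqn (a *: v) = nc a ^+ 2 * sqn v.
Proof. by rewrite mulr_sumr; apply: eq_bigr => i _; rewrite mxE ncM exprMn. Qed.

Lemma enormZ d (a : R[i]) (v : 'cV[R[i]]_d) : enorm (a *: v) = nc a * enorm v.
Proof.
by rewrite /enorm sqnZ sqrtrM ?sqr_ge0// sqrtr_sqr ger0_norm ?nc_ge0.
Qed.

Lemma le_enorm d (v : 'cV[R[i]]_d) (c : R) : 0 <= c ->
  (enorm v <= c) = (sqn v <= c ^+ 2).
Proof. by move=> c0; rewrite -sqr_enorm ler_sqr // nnegrE enorm_ge0. Qed.

Lemma sum_mul_le_sqrt (I : finType) (a b : I -> R) :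
  \sum_i a i * b i <= Num.sqrt (\sum_i a i ^+ 2) * Num.sqrt (\sum_i b i ^+ 2).
Proof.
rewrite -sqrtrM; last by apply: sumr_ge0 => i _; exact: sqr_ge0.
apply: le_trans (ler_norm _) _; rewrite -sqrtr_sqr.
exact/ler_wsqrtr/CauchySchwarz_sum.
Qed.

Lemma enormD d (u v : 'cV[R[i]]_d) : enorm (u + v) <= enorm u + enorm v.
Proof.
rewrite le_enorm ?addr_ge0 ?enorm_ge0// sqrrD !sqr_enorm.
apply: (@le_trans _ _ (\sum_i (nc (u i 0) + nc (v i 0)) ^+ 2)).
  apply: ler_sum => i _; rewrite mxE ler_sqr ?nnegrE ?addr_ge0 ?nc_ge0//.
  exact: ncD.
under eq_bigr do rewrite sqrrD.
rewrite !big_split /= lerD2r lerD2l -mulr2n lerMn2r /=.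
exact: sum_mul_le_sqrt.
Qed.

Lemma nc_le_enorm d (v : 'cV[R[i]]_d) i : nc (v i 0) <= enorm v.
Proof.
rewrite -ler_sqr ?nnegrE ?nc_ge0 ?enorm_ge0// sqr_enorm /sqn (bigD1 i) //=.
by rewrite lerDl; apply: sumr_ge0 => j _; exact: sqr_ge0.
Qed.

Lemma enorm_eq0 d (v : 'cV[R[i]]_d) : enorm v = 0 -> v = 0.
Proof.
move=> v0; apply/colP => i; rewrite mxE; apply: ComplexField.Normc.eq0_normc.
by apply/eqP; rewrite eq_le nc_ge0 -v0 nc_le_enorm.
Qed.

Lemma enorm_is_norm d : is_norm (@enorm d).
Proof.
split; [exact: enorm_ge0|exact: enorm_eq0|exact: enormZ|exact: enormD].
Qed.

Lemma enorm_mulmx d (A : 'M[R[i]]_d) v : enorm (A *m v) <= Num.sqrt (fro2 A) * enorm v.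
Proof.
rewrite le_enorm ?mulr_ge0 ?sqrtr_ge0// exprMn sqr_sqrtr ?fro2_ge0// sqr_enorm.
rewrite /fro2 mulr_suml; apply: ler_sum => i _; rewrite mxE.
apply: le_trans (CauchySchwarz_sum _ _).
rewrite ler_sqr ?nnegrE ?nc_ge0//; last first.
  by apply: sumr_ge0 => j _; rewrite mulr_ge0 ?nc_ge0.
by apply: le_trans (nc_sum _ _ _) _; apply: ler_sum => j _; rewrite ncM.
Qed.

Lemma fro2_cols d (A : 'M[R[i]]_d) : fro2 A = \sum_j sqn (col j A).
Proof.
rewrite /fro2 exchange_big; apply: eq_bigr => j _.
by apply: eq_bigr => i _; rewrite mxE.
Qed.

End Euclidean.

(** * Splitting matrices along a weight on the basis *)

Section Truncation.
Variables (R : realType) (d : nat) (D : 'I_d -> R).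
Implicit Types A L : 'M[R[i]]_d.

(** Strictly triangular once the basis is sorted by [D]; the diagonal and all ties go to [upp]. *)
Definition low A := \matrix_(i, j) (if D i < D j then A i j else 0).
Definition upp A := \matrix_(i, j) (if D j <= D i then A i j else 0).

Lemma low_upp A : A = upp A + low A.
Proof.
by apply/matrixP => i j; rewrite !mxE ltNge; case: ifP; rewrite ?addr0 ?add0r.
Qed.

(** Replaces a permutation sorting the basis: equal weights share a rank, and a nonzero entry
    [(i, j)] of [low A] has a column of higher rank than its row. *)
Definition weight_rank j := #|[pred l | D l < D j]|.

Lemma weight_rank_lt i j : D i < D j -> (weight_rank i < weight_rank j)%N.
Proof.
move=> ij; apply: proper_card; apply/properP; split.
  by apply/fintype.subsetP => l; rewrite !inE => /lt_trans; apply.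
by exists i; rewrite !inE ?ltxx.
Qed.

Lemma weight_rank_ltn j : (weight_rank j < d)%N.
Proof.
rewrite -[X in (_ < X)%N]card_ord; apply: proper_card; apply/properP.
by split; [apply/fintype.subsetP|exists j; rewrite !inE ?ltxx].
Qed.

Lemma sqn_col_low A j : sqn (col j (low A)) <= sqn (col j A).
Proof.
apply: ler_sum => i _; rewrite !mxE ler_sqr ?nnegrE ?nc_ge0//.
by case: ifP => // _; rewrite nc0 nc_ge0.
Qed.

Lemma enorm_delta j : enorm (delta_mx j 0 : 'cV[R[i]]_d) = 1.
Proof.
rewrite /enorm /sqn (bigD1 j)//= mxE !eqxx nc1.
rewrite big1 ?addr0 ?expr1n ?sqrtr1// => i ij.
by rewrite mxE (negbTE ij) /= nc0 expr0n.
Qed.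

(** Each column of [A] is the image of a unit vector, hence of length at most [a]. In [low A] a
    column of minimal weight vanishes, which leaves [d.-1] columns. *)
Lemma fro2_low A a : 0 <= a -> (forall x, enorm (A *m x) <= a * enorm x) ->
  fro2 (low A) <= d.-1%:R * a ^+ 2.
Proof.
move=> a0 hA; rewrite fro2_cols.
have hc j : sqn (col j (low A)) <= a ^+ 2.
  apply: le_trans (sqn_col_low _ _) _.
  by rewrite -le_enorm// colE -[leRHS]mulr1 -(enorm_delta j).
case: (pickP 'I_d) => [j1 _|no]; last first.
  by rewrite big1 ?mulr_ge0 ?ler0n ?sqr_ge0// => j _; move: (no j).
have [j0 _ hj0] := Order.TotalTheory.arg_minP D (isT : xpredT j1).
rewrite (bigD1 j0)//= [X in X + _]big1 ?add0r => [|i _]; last first.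
  by rewrite !mxE ltNge hj0//= nc0 expr0n.
apply: le_trans (ler_sum _ (fun j _ => hc j)) _.
by rewrite sumr_const (cardC1 j0) card_ord mulr_natl.
Qed.

(** [L] is the product of the [low] parts. The error is a sum of products with a single factor [upp]
    and [k] factors [low] to its right, each of which costs [Num.sqrt d.-1%:R * a] in place of
    [a]. *)
Lemma truncated_mxprods (AA : set 'M[R[i]]_d) (a u : R) n :
    0 <= a -> 0 <= u ->
    (forall A, AA A -> forall x, enorm (A *m x) <= a * enorm x) ->
    (forall A, AA A -> fro2 (upp A) <= u ^+ 2) ->
  forall B, mxprods AA n.+1 B -> exists L : 'M[R[i]]_d,
  [/\ forall x, enorm (B *m x - L *m x) <=
        u * a ^+ n * (\sum_(k < n.+1) Num.sqrt d.-1%:R ^+ k) * enorm x,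
      forall x, enorm (L *m x) <= (Num.sqrt d.-1%:R * a) ^+ n.+1 * enorm x
    & forall i j, L i j != 0 -> (weight_rank i + n.+1 <= weight_rank j)%N].
Proof.
move=> a0 u0 ha hu; set q := Num.sqrt d.-1%:R.
have q0 : 0 <= q by exact: sqrtr_ge0.
have hup A x : AA A -> enorm (upp A *m x) <= u * enorm x.
  move=> AA_A; apply: le_trans (enorm_mulmx _ _) _.
  rewrite ler_wpM2r ?enorm_ge0// -[leRHS]ger0_norm// -sqrtr_sqr.
  exact/ler_wsqrtr/hu.
have hlow A x : AA A -> enorm (low A *m x) <= (q * a) * enorm x.
  move=> AA_A; apply: le_trans (enorm_mulmx _ _) _.
  rewrite ler_wpM2r ?enorm_ge0//.
  rewrite -[X in q * X]ger0_norm// -sqrtr_sqr -sqrtrM ?ler0n//.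
  apply/ler_wsqrtr/fro2_low => //; exact: ha.
have lowr A i j : low A i j != 0 -> (weight_rank i < weight_rank j)%N.
  by rewrite mxE; case: ifP => [/weight_rank_lt//|_]; rewrite eqxx.
elim: n => [|n IH] B [A AA_A [B' hB' <-{B}]].
  rewrite hB' mulmx1; exists (low A); split=> [x|x|i j /lowr]; last by rewrite addn1.
    rewrite -mulmxBl {1}[A]low_upp addrK big_ord1 !expr0 !mulr1; exact: hup.
  by rewrite expr1; exact: hlow.
have [L [h1 h2 h3]] := IH _ hB'; exists (low A *m L); split=> [x|x|i j].
(* Telescoping: the previous error is multiplied by [A], and the new term pairs [upp A] with the
   previous product of [low] parts. *)
- have -> : A *m B' *m x - low A *m L *m x =
     A *m (B' *m x - L *m x) + upp A *m (L *m x).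
    have -> : upp A = A - low A by rewrite {2}(low_upp A) addrK.
    by rewrite mulmxBr mulmxBl -!mulmxA addrA subrK.
  apply: le_trans (enormD _ _) _.
  apply: (@le_trans _ _ (a * (u * a ^+ n * (\sum_(k < n.+1) q ^+ k) * enorm x)
     + u * ((q * a) ^+ n.+1 * enorm x))).
    apply: lerD; first by apply: le_trans (ha _ AA_A _) _; rewrite ler_wpM2l.
    by apply: le_trans (hup _ _ AA_A) _; rewrite ler_wpM2l.
  rewrite [in leRHS]big_ord_recr /= exprMn !exprS le_eqVlt; apply/orP; left.
  by apply/eqP; ring.
- rewrite -mulmxA; apply: le_trans (hlow _ _ AA_A) _.
  by rewrite [in leRHS]exprS -[leRHS]mulrA ler_wpM2l ?mulr_ge0.
- rewrite mxE => nz.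
  have [k] : exists k, low A i k * L k j != 0.
    apply: contrapT => /forallNP H; move/eqP: nz; apply.
    by apply: big1 => k _; apply/eqP/negPn/negP; exact: H.
  rewrite mulf_eq0 negb_or => /andP[/lowr ik /h3 kj].
  by apply: leq_trans kj; rewrite addnS -addSn ltn_add2r.
Qed.

(** A nonzero entry in a product of [d] factors [low] would raise the rank by [d], while all ranks
    are below [d]; only the telescoped error is left. *)
Lemma enorm_mxprods (AA : set 'M[R[i]]_d) (a u : R) :
    0 <= a -> 0 <= u -> (0 < d)%N ->
    (forall A, AA A -> forall x, enorm (A *m x) <= a * enorm x) ->
    (forall A, AA A -> fro2 (upp A) <= u ^+ 2) ->
  forall B, mxprods AA d B -> forall x, enorm (B *m x) <=
    u * a ^+ d.-1 * (\sum_(k < d) Num.sqrt d.-1%:R ^+ k) * enorm x.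
Proof.
move=> a0 u0 d0 ha hu B hB x.
rewrite -[in X in mxprods _ X](prednK d0) in hB.
have [L [h _ hL]] := truncated_mxprods a0 u0 ha hu hB.
have L0 : L = 0.
  apply/matrixP => i j; rewrite mxE; apply/eqP/negPn/negP => /hL.
  by rewrite (prednK d0) => /(leq_trans (leq_addl _ _)); rewrite leqNgt weight_rank_ltn.
have := h x; rewrite L0 mul0mx subr0; congr (_ <= _ * _ * _).
by rewrite -(big_mkord xpredT (fun k => Num.sqrt d.-1%:R ^+ k)) (prednK d0) big_mkord.
Qed.

End Truncation.

(** * Equivalence of norms in finite dimension *)

Section NormEquivalence.
Variables (R : realType) (d : nat) (N : 'cV[R[i]]_d -> R).
Hypothesis hN : is_norm N.
Implicit Types u v : 'cV[R[i]]_d.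

Lemma is_norm0 : N 0 = 0.
Proof. by rewrite -(scale0r 0) (is_normZ hN) nc0 mul0r. Qed.

Lemma is_normN v : N (- v) = N v.
Proof. by rewrite -scaleN1r (is_normZ hN) ncN nc1 mul1r. Qed.

Lemma is_norm_sum (I : Type) (r : seq I) (P : pred I) (F : I -> 'cV[R[i]]_d) :
  N (\sum_(i <- r | P i) F i) <= \sum_(i <- r | P i) N (F i).
Proof.
elim/big_ind2: _ => //; first by rewrite is_norm0.
by move=> x a y b xa yb; apply: le_trans (is_norm_triangle hN _ _) (lerD xa yb).
Qed.

Lemma is_norm_dist u v : `|N u - N v| <= N (u - v).
Proof.
have H x y : N x - N y <= N (x - y).
  by rewrite lerBlDr -{1}(subrK y x); exact: (is_norm_triangle hN).
have := H u v; have := H v u; rewrite -[v - u]opprB is_normN => h1 h2.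
by rewrite ler_norml h2 andbT; lra.
Qed.

Lemma is_norm_le_coord v : N v <= \sum_i nc (v i 0) * N (delta_mx i 0).
Proof.
have {1}-> : v = \sum_i v i 0 *: delta_mx i 0.
  rewrite {1}[v]matrix_sum_delta; apply: eq_bigr => i _.
  by rewrite big_ord1.
apply: le_trans (is_norm_sum _ _ _) _.
by apply: ler_sum => i _; rewrite (is_normZ hN).
Qed.

Lemma norm_le_enorm : exists2 K, 0 <= K & forall v, N v <= K * enorm v.
Proof.
exists (\sum_i N (delta_mx i 0)); first by apply: sumr_ge0 => i _; exact: is_norm_ge0.
move=> v; apply: le_trans (is_norm_le_coord v) _.
rewrite mulr_suml; apply: ler_sum => i _; rewrite mulrC.
by rewrite ler_wpM2l ?nc_le_enorm// (is_norm_ge0 hN).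
Qed.

End NormEquivalence.

Section Compactness.
Variables (R : realType) (d : nat) (N : 'cV[R[i]]_d -> R).
Hypothesis hN : is_norm N.

(** Real coordinates on the complex space, real parts first, so that closed bounded sets of real
    vectors give compactness. *)
Let cplx (x : 'rV[R]_(d + d)) : 'cV[R[i]]_d :=
  \col_i (x 0 (lshift d i) +i* x 0 (rshift d i))%C.

Let cplxB x y : cplx (x - y) = cplx x - cplx y.
Proof. by apply/colP => i; rewrite !mxE. Qed.

Let cplxZ (a : R) x : cplx (a *: x) = a%:C%C *: cplx x.
Proof.
apply/colP => i; rewrite !mxE; apply/eqP; rewrite eq_complex /=.
by rewrite !mul0r subr0 addr0 !eqxx.
Qed.

Let coord_le_norm n (x : 'rV[R]_n) j : `|x 0 j| <= `|x|.
Proof.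
rewrite [leRHS]/Num.norm /= mx_normrE.
exact: (le_bigmax _ (fun ij => `|x ij.1 ij.2|) (0, j)).
Qed.

Let nc_cplx x i : nc (cplx x i 0) <= 2 * `|x|.
Proof.
rewrite mxE (complexE (_ +i* _)%C) /=; apply: le_trans (ncD _ _) _.
rewrite ncM !nc_real [X in _ + X * _](_ : _ = 1) ?mul1r ?mulr2n ?mulrDl ?mul1r.
  by apply: lerD; exact: coord_le_norm.
by rewrite /ComplexField.Normc.normc expr0n expr1n add0r sqrtr1.
Qed.

(** [N] is continuous and has a positive minimum on the compact unit sphere of the real coordinates;
    homogeneity does the rest. *)
Lemma enorm_le_norm : exists2 c, 0 < c & forall v, c * enorm v <= N v.
Proof.
pose f x := N (cplx x).
have hup (M : 'cV[R[i]]_d -> R) : is_norm M ->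
    exists2 K, 0 < K & forall x, M (cplx x) <= K * `|x|.
  move=> hM; exists (2 * (\sum_i M (delta_mx i 0)) + 1).
    by rewrite ltr_wpDl// mulr_ge0// sumr_ge0// => i _; exact: is_norm_ge0.
  move=> x; apply: le_trans (is_norm_le_coord hM _) _.
  apply: (@le_trans _ _ (2 * (\sum_i M (delta_mx i 0)) * `|x|)).
    rewrite mulr_sumr mulr_suml; apply: ler_sum => i _.
    by rewrite mulrAC ler_wpM2r ?nc_cplx// (is_norm_ge0 hM).
  by rewrite ler_wpM2r// lerDl.
have [K K0 hK] := hup _ hN.
have [E E0 hE] := hup _ (@enorm_is_norm R d).
have cf : continuous f.
  move=> x; apply: (proj2 (@cvgrPdist_lt R R _ (nbhs x) (@nbhs_filter _ x) f (f x))) => e e0; near=> y.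
  apply: le_lt_trans (is_norm_dist hN _ _) _; rewrite -cplxB.
  apply: le_lt_trans (hK _) _; rewrite -ltr_pdivlMl//.
  near: y; apply: (@cvgr_dist_lt _ _ _ (nbhs x) _ id) => //.
  by rewrite mulr_gt0// invr_gt0.
pose S : set 'rV[R]_(d + d) := [set x | `|x| = 1].
pose re (v : 'cV[R[i]]_d) : 'rV[R]_(d + d) :=
  \row_(j < d + d) (match fintype.split j with inl i => complex.Re (v i 0) | inr i => complex.Im (v i 0) end).
have reK v : cplx (re v) = v.
  apply/colP => i; rewrite !mxE (unsplitK (inl i)) (unsplitK (inr i)).
  by case: (v i 0).
have unit_sphere (x : 'rV[R]_(d + d)) : x != 0 -> S (`|x|^-1 *: x).
  by move=> x0; rewrite /S /= normrZ normfV normr_id mulVf// normr_eq0.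
(* The sphere is empty only for [d = 0], and then every vector is zero. *)
have [[x0 Sx0]|S0] := pselect (S !=set0); last first.
  exists 1 => // v; suff -> : v = 0 by rewrite (is_norm0 hN) (is_norm0 (enorm_is_norm R d)) mulr0.
  rewrite -(reK v); have [->|/unit_sphere rv] := eqVneq (re v) 0.
    by apply/colP => i; rewrite !mxE.
  by case: S0; exists (`|re v|^-1 *: re v).
have cS : compact S.
  apply: bounded_closed_compact; first by exists 1; split => // r r1 x; rewrite /S /= => ->; exact: ltW.
  have -> : S = (fun x => `|x|) @^-1` [set 1] by [].
  apply: closed_comp; last exact: closed_eq.
  by move=> x _; exact: norm_continuous.
have [c Sc hc] := compact_EVT_min (ex_intro _ x0 Sx0) cS (continuous_subspaceT cf).
have fc0 : 0 < f c.
  rewrite lt_neqAle (is_norm_ge0 hN) andbT eq_sym; apply/eqP => /(is_norm_eq0 hN) c0.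
  move: Sc; rewrite inE /S /=.
  suff -> : c = 0 by rewrite normr0 => /esym/eqP; rewrite oner_eq0.
  apply/rowP => j; rewrite mxE -(splitK j).
  by case: (fintype.split j) => i; move/colP/(_ i): c0; rewrite !mxE => /eqP;
    rewrite eq_complex /= => /andP[/eqP h1 /eqP h2].
(* On the sphere [N] is at least [f c] and the Euclidean norm at most [E]. *)
exists (f c / E); first by rewrite divr_gt0.
move=> v; rewrite -(reK v); have [->|rv0] := eqVneq (re v) 0.
  have -> : cplx 0 = 0 by apply/colP => i; rewrite !mxE.
  by rewrite (is_norm0 hN) (is_norm0 (enorm_is_norm R d)) mulr0.
have n0 : 0 < `|re v| by rewrite normr_gt0.
have := hc _ (mem_set (unit_sphere _ rv0)).
rewrite /f cplxZ (is_normZ hN) nc_nneg ?invr_ge0// ler_pdivlMl// => h.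
apply: le_trans h; rewrite -/(f c) -mulrA [leRHS]mulrC ler_wpM2l ?(ltW fc0)//.
by rewrite ler_pdivrMl.
Unshelve. all: by end_near.
Qed.

End Compactness.

(** * Ellipsoids of nearly maximal volume in a unit ball *)

Lemma det_1D_rank1 (F : comNzRingType) (d : nat) (u : 'cV[F]_d) (v : 'rV[F]_d) :
  \det (1%:M + u *m v) = 1 + (v *m u) 0 0.
Proof.
(* Both sides are the determinant of this block matrix, factored into triangular blocks in two
   ways. *)
pose X : 'M[F]_(d + 1) := block_mx 1%:M (- u) v 1%:M.
have E1 : X = block_mx 1%:M 0 v 1%:M *m block_mx 1%:M (- u) 0 (1%:M + v *m u).
  rewrite mulmx_block !(mul1mx, mulmx1, mul0mx, mulmx0, addr0, mulmxN).
  by rewrite addrC addrK.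
have E2 : X = block_mx (1%:M + u *m v) (- u) 0 1%:M *m block_mx 1%:M 0 v 1%:M.
  rewrite mulmx_block !(mul1mx, mulmx1, mul0mx, mulmx0, addr0, add0r, mulNmx).
  by rewrite addrK.
have := congr1 determinant E1; rewrite {1}E2 !det_mulmx !det_lblock !det_ublock.
by rewrite !det1 !mulr1 !mul1r det_mx11 !mxE /= mulr1n.
Qed.

Section JohnStep.
Variables (R : realType) (d : nat) (N : 'cV[R[i]]_d -> R).
Hypothesis hN : is_norm N.
Hypothesis N_le : forall x, N x <= enorm x.

(* The unit ball of [N] contains the Euclidean ball and a point at distance [k];
   the ellipsoid stretched by [a] in the direction [w] of that point and shrunk
   by [b] orthogonally to it still lies in their absolutely convex hull. *)
Lemma stretched_ellipsoid (w : 'cV[R[i]]_d) (k a b : R) :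
    enorm w = 1 -> 1 < k -> k * N w <= 1 -> 1 <= a -> 0 < b -> b <= 1 ->
    a ^+ 2 + (k ^+ 2 - 1) * b ^+ 2 = k ^+ 2 ->
  exists2 W : 'M[R[i]]_d, nc (\det W) = a * b ^+ d.-1 &
    forall x, N (W *m x) <= enorm x.
Proof.
move=> w1 k1 kw a1 b0 b1 abk.
have a0 : 0 < a by exact: lt_le_trans a1.
have k0 : 0 < k by exact: lt_trans k1.
pose ws : 'rV[R[i]]_d := map_mx Num.conj w^T.
pose c : R := (a - b) / b.
have ww : hdot w w = 1 by rewrite -sqnE -sqr_enorm w1 expr1n.
have d0 : (0 < d)%N.
  case: (posnP d) => // d0; move: w1; rewrite /enorm /sqn big1 ?sqrtr0 => [/esym/eqP|i _].
    by rewrite oner_eq0.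
  by have := ltn_ord i; rewrite {2}d0.
(* This matrix multiplies [w] by [a], since [b * (1 + c) = a], and acts as [b] on the orthogonal
   complement of [w]. *)
exists (b%:C%C *: (1%:M + (c%:C%C *: w) *m ws)).
  rewrite detZ det_1D_rank1 -scalemxAr mxE -hdotE ww mulr1 ncM ncX nc_nneg ?ltW//.
  rewrite -[1 + _](rmorphD (real_complex R) 1) nc_nneg; last first.
    by rewrite addr_ge0// divr_ge0 ?(ltW b0)// subr_ge0 (le_trans b1).
  have -> : b ^+ d = b ^+ d.-1 * b by rewrite -exprSr prednK.
  rewrite /c; field; exact: lt0r_neq0.
move=> x; pose zc := hdot w x; pose y := x - zc *: w.
have wy : hdot w y = 0 by rewrite hdotDr -scaleN1r !hdotZr ww mulr1 mulN1r subrr.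
have hsq (p : R[i]) (q : R) : sqn (p *: w + q%:C%C *: y) = nc p ^+ 2 + q ^+ 2 * sqn y.
  rewrite sqnD_orth; last by rewrite hdotZr hdotC hdotZr (hdotC y) wy !(conjC0, mulr0).
  by rewrite !sqnZ -sqr_enorm w1 expr1n mulr1 nc_real real_normK// num_real.
have xE : x = zc *: w + 1%:C%C *: y by rewrite scale1r addrC subrK.
set z := nc zc; set t := enorm y.
have z0 : 0 <= z by exact: nc_ge0.
have t0 : 0 <= t by exact: enorm_ge0.
have sx : sqn x = z ^+ 2 + t ^+ 2 by rewrite {1}xE hsq expr1n mul1r sqr_enorm.
have WxE : b%:C%C *: (1%:M + (c%:C%C *: w) *m ws) *m x = (a%:C%C * zc) *: w + b%:C%C *: y.
  have wsx : ws *m x = zc%:M.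
    by apply/matrixP => i j; rewrite !ord1 -hdotE mxE eqxx.
  have ac : a%:C%C = b%:C%C + b%:C%C * c%:C%C :> R[i].
    by rewrite -rmorphM -rmorphD /c; congr (_%:C)%C; field; exact: lt0r_neq0.
  rewrite -scalemxAl mulmxDl mul1mx -mulmxA wsx mul_mx_scalar scalerDr !scalerA.
  rewrite {1}xE scale1r scalerDr scalerA addrAC -scalerDl ac.
  by congr (_ *: _ + _); ring.
rewrite WxE.
have k2 : 0 < k ^+ 2 - 1 by rewrite subr_gt0 expr_gt1// ltW.
pose s := Num.sqrt (k ^+ 2 - 1).
have s0 : 0 < s by rewrite sqrtr_gt0.
have s2 : s ^+ 2 = k ^+ 2 - 1 by rewrite sqr_sqrtr// ltW.
rewrite -s2 in abk.
(* A tangent from [k *: w] touches the Euclidean sphere in a direction of slope [s] relative to [w].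
   If the image of [x] is at least that steep, its Euclidean norm is already at most that of [x]. *)
have [small|big] := leP (a * z * s) (b * t).
  apply: le_trans (N_le _) _; rewrite le_enorm ?enorm_ge0// sqr_enorm hsq sx.
  rewrite ncM nc_nneg ?(ltW a0)// -sqr_enorm -/t -/z exprMn.
  have h1 : s * z <= t.
    apply: (@le_trans _ _ (a * z * s)); last first.
      by apply: le_trans small _; rewrite -[leRHS]mul1r ler_wpM2r.
    by rewrite mulrC -[z in leLHS]mul1r !ler_wpM2r// ltW.
  have h2 : (s * z) ^+ 2 <= t ^+ 2 by rewrite ler_sqr ?nnegrE// mulr_ge0// ltW.
  have b2 : 0 <= 1 - b ^+ 2 by rewrite subr_ge0 expr_le1// ltW.
  have := ler_wpM2l b2 h2.
  have -> : a ^+ 2 = k ^+ 2 - s ^+ 2 * b ^+ 2 by rewrite -abk addrK.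
  have -> : k ^+ 2 = 1 + s ^+ 2 by rewrite s2 addrC subrK.
  by rewrite exprMn; lra.
have zp : 0 < z.
  rewrite lt_neqAle z0 andbT; apply/eqP => z_0; move: big.
  by rewrite -z_0 mulr0 mul0r ltNge mulr_ge0// ltW.
(* Otherwise a multiple of [w] is split off so that the rest has slope exactly [s], hence Euclidean
   norm [k * e * z]; the part split off is measured with [k * N w <= 1]. *)
pose e := b * t / (s * z).
have ez : e * z * s = b * t by rewrite /e; field; rewrite !lt0r_neq0.
have e0 : 0 <= e by rewrite /e divr_ge0 ?mulr_ge0 ?(ltW b0) ?(ltW s0).
have ea : e <= a.
  by rewrite /e ler_pdivrMr ?mulr_gt0// [s * z]mulrC mulrA ltW.
have -> : (a%:C%C * zc) *: w + b%:C%C *: y =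
    ((a - e)%:C%C * zc) *: w + ((e%:C%C * zc) *: w + b%:C%C *: y).
  by rewrite rmorphB addrA -scalerDl -mulrDl subrK.
apply: le_trans (is_norm_triangle hN _ _) _.
apply: (@le_trans _ _ ((a - e) * z / k + k * e * z)).
  apply: lerD.
    rewrite (is_normZ hN) ncM nc_nneg ?subr_ge0// -mulrA -mulrA.
    by rewrite ler_wpM2l ?subr_ge0// ler_wpM2l// -[k^-1]mul1r ler_pdivlMr// mulrC.
  apply: le_trans (N_le _) _; rewrite le_enorm; last first.
    exact: (mulr_ge0 (mulr_ge0 (ltW k0) e0) z0).
  rewrite hsq ncM nc_nneg// -sqr_enorm -/t -/z -exprMn -ez.
  have -> : (k * e * z) ^+ 2 = k ^+ 2 * (e * z) ^+ 2 by ring.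
  have -> : k ^+ 2 = 1 + s ^+ 2 by rewrite s2 addrC subrK.
  by rewrite le_eqVlt; apply/orP; left; apply/eqP; ring.
have -> : (a - e) * z / k + k * e * z = (a * z + s * (b * t)) / k.
  rewrite -ez.
  have -> : s * (e * z * s) = (k ^+ 2 - 1) * e * z by rewrite -s2; ring.
  by field; exact: lt0r_neq0.
(* What remains is Cauchy-Schwarz for [(a, s * b)] and [(z, t)], as
   [a ^+ 2 + s ^+ 2 * b ^+ 2 = k ^+ 2]. *)
rewrite ler_pdivrMr// -ler_sqr ?nnegrE ?addr_ge0 ?mulr_ge0 ?enorm_ge0 ?(ltW a0) ?(ltW s0) ?(ltW b0) ?(ltW k0)//.
rewrite [leRHS]exprMn sqr_enorm sx -abk.
have : 0 <= (a * t - s * b * z) ^+ 2 by exact: sqr_ge0.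
by lra.
Qed.

End JohnStep.

(** A crude consequence of the Leibniz expansion, enough to bound the volumes of the ellipsoids
    inside a unit ball. *)
Lemma nc_det_le (R : realType) (d : nat) (A : 'M[R[i]]_d) (c : R) :
  (forall i j, nc (A i j) <= c) -> nc (\det A) <= d`!%:R * c ^+ d.
Proof.
move=> hc; apply: le_trans (nc_sum _ _ _) _.
apply: (@le_trans _ _ (\sum_(s : 'S_d) c ^+ d)); last first.
  by rewrite sumr_const -cardsT -card_Sn cardsT mulr_natl.
apply: ler_sum => s _.
have -> : nc ((-1) ^+ s * \prod_i A i (s i)) = \prod_i nc (A i (s i)).
  rewrite ncM ncX ncN nc1 expr1n mul1r.
  by elim/big_rec2: _ => [|i x y _ <-]; rewrite ?nc1 ?ncM.
rewrite -[X in c ^+ X]card_ord -prodr_const.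
by apply: ler_prod => i _; rewrite nc_ge0 hc.
Qed.

Lemma bernoulli_1B (R : realType) (e : R) n : 0 <= e -> e <= 1 ->
  1 - n%:R * e <= (1 - e) ^+ n.
Proof.
move=> e0 e1; elim: n => [|n IH]; first by rewrite mul0r subr0 expr0.
rewrite exprS; apply: (@le_trans _ _ ((1 - e) * (1 - n%:R * e))).
  rewrite -natr1; suff : 0 <= n%:R * e ^+ 2 by lra.
  by rewrite mulr_ge0 ?sqr_ge0.
by rewrite ler_wpM2l// subr_ge0.
Qed.

(** With [a ^+ 2 = 1 + e * (k ^+ 2 - 1)] and [b ^+ 2 = 1 - e] the constraint holds identically, and
    the square of [a * b ^+ d.-1] has derivative [k ^+ 2 - d%:R > 0] at [e = 0]. A small explicit
    [e] and Bernoulli's inequality conclude. *)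
Lemma john_axes (R : realType) (d : nat) (k : R) : (0 < d)%N -> 1 < k ->
  d%:R < k ^+ 2 -> exists a b : R, [/\ 1 <= a, 0 < b, b <= 1,
    a ^+ 2 + (k ^+ 2 - 1) * b ^+ 2 = k ^+ 2 & 1 < a * b ^+ d.-1].
Proof.
move=> d0 k1 dk; have dE : d%:R = d.-1%:R + 1 :> R by rewrite natr1 prednK.
have p0 : 0 <= d.-1%:R :> R by rewrite ler0n.
have k2 : 1 < k ^+ 2 by rewrite expr_gt1// ltW// (lt_trans _ k1).
set m : R := d.-1%:R in dE p0; rewrite dE in dk; set K := k ^+ 2 in dk k2 *.
pose e := (K - (m + 1)) / (2 * K * (m + 1)).
have den : 0 < 2 * K * (m + 1) by rewrite !mulr_gt0 ?ltr_wpDl//; lra.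
have eE : e * (2 * K * (m + 1)) = K - (m + 1) by rewrite /e divfK// lt0r_neq0.
have e0 : 0 < e by rewrite divr_gt0// subr_gt0.
have e1 : e < 1.
  rewrite /e ltr_pdivrMr// mul1r; have : 0 <= K * m by apply: mulr_ge0 => //; lra.
  by lra.
have a2 : 1 <= 1 + e * (K - 1) by rewrite lerDl mulr_ge0 ?subr_ge0 ?ltW.
have b2 : 0 < 1 - e by rewrite subr_gt0.
exists (Num.sqrt (1 + e * (K - 1))), (Num.sqrt (1 - e)); split.
- by rewrite -[leLHS]sqrtr1 ler_wsqrtr.
- by rewrite sqrtr_gt0.
- by rewrite -[leRHS]sqrtr1 ler_wsqrtr//; lra.
- by rewrite !sqr_sqrtr ?ltW ?(lt_le_trans ltr01 a2)//; ring.
rewrite -ltr_sqr ?nnegrE ?mulr_ge0 ?exprn_ge0 ?sqrtr_ge0// expr1n exprMn.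
rewrite sqr_sqrtr ?(le_trans ler01 a2)// -exprM mulnC exprM sqr_sqrtr ?ltW//.
apply: (@lt_le_trans _ _ ((1 + e * (K - 1)) * (1 - m * e))); last first.
  by rewrite ler_wpM2l ?(le_trans ler01 a2)// bernoulli_1B// ltW.
have : 0 < e * (K - (m + 1) - e * (K - 1) * m).
  rewrite mulr_gt0// -eE; have : 0 < e * (2 * K * (m + 1) - (K - 1) * m).
    rewrite mulr_gt0//; have : 0 <= K * m by apply: mulr_ge0 => //; lra.
    by lra.
  by lra.
by lra.
Qed.

Lemma is_norm_comp (R : realType) (d : nat) (N : 'cV[R[i]]_d -> R) (T : 'M[R[i]]_d) :
  is_norm N -> T \in unitmx -> is_norm (fun x => N (T *m x)).
Proof.
move=> hN uT; split=> [v|v /(is_norm_eq0 hN) Tv|a v|u v].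
- exact: is_norm_ge0.
- by rewrite -[v]mul1mx -(mulVmx uT) -mulmxA Tv mulmx0.
- by rewrite -scalemxAr (is_normZ hN).
- by rewrite mulmxDr (is_norm_triangle hN).
Qed.

(* An ellipsoid of nearly maximal volume in the unit ball, instead of the
   maximal one of John's theorem: this loses an arbitrarily small factor but
   needs no compactness argument on matrices. *)
Lemma john_approx (R : realType) (d : nat) (N : 'cV[R[i]]_d -> R) (k : R) :
    is_norm N -> (0 < d)%N -> 1 < k -> d%:R < k ^+ 2 ->
  exists2 T : 'M[R[i]]_d, T \in unitmx &
    forall x, N (T *m x) <= enorm x /\ enorm x <= k * N (T *m x).
Proof.
move=> hN d0 k1 dk; have [a [b [a1 b0 b1 abk g1]]] := john_axes d0 k1 dk.
have [c c0 hc] := enorm_le_norm hN; have [K K0 hK] := norm_le_enorm hN.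
(* [S] describes the ellipsoids inside the unit ball of [N]; the modulus of the determinant measures
   their size. *)
pose S := [set T : 'M[R[i]]_d | forall x, N (T *m x) <= enorm x].
pose V := [set nc (\det T) | T in S].
have Vub : ubound V (d`!%:R * c^-1 ^+ d).
  move=> _ [T ST <-]; apply: nc_det_le => i j.
  rewrite -[c^-1]mulr1 ler_pdivlMl//.
  have -> : T i j = (T *m delta_mx j 0 : 'cV_d) i 0 by rewrite -colE mxE.
  apply: le_trans (_ : c * enorm (T *m delta_mx j 0) <= _).
    by rewrite ler_wpM2l ?nc_le_enorm// ltW.
  by apply: le_trans (hc _) _; rewrite -(enorm_delta R j).
pose dl := (K + 1)^-1.
have K1 : 0 < K + 1 by rewrite ltr_wpDl.
have Vdl : V (dl ^+ d).
  exists dl%:C%C%:M; last by rewrite det_scalar ncX nc_nneg// invr_ge0 ltW.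
  move=> x; rewrite mul_scalar_mx (is_normZ hN) nc_nneg ?invr_ge0 ?(ltW K1)//.
  rewrite /dl ler_pdivrMl//; apply: le_trans (hK _) _.
  by rewrite ler_wpM2r ?enorm_ge0// lerDl.
have hsup : has_sup V by split; [exists (dl ^+ d)|exists (d`!%:R * c^-1 ^+ d)].
have s0 : 0 < sup V.
  apply: lt_le_trans (ub_le_sup _ Vdl); last by case: hsup.
  by rewrite exprn_gt0// invr_gt0.
(* This ellipsoid is so close to the supremum that it cannot be enlarged by the factor
   [a * b ^+ d.-1]. *)
have [_ [T ST <-] hT] : exists2 y, V y & sup V / (a * b ^+ d.-1) < y.
  have /(sup_adherent)/(_ hsup)[y Vy hy] : 0 < sup V - sup V / (a * b ^+ d.-1).
    by rewrite subr_gt0 ltr_pdivrMr ?(lt_trans _ g1)// ltr_pMr.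
  by exists y => //; rewrite subKr in hy.
have uT : T \in unitmx.
  rewrite unitmxE unitfE; apply/eqP => T0; move: hT; rewrite T0 nc0 ltNge.
  by rewrite divr_ge0// ltW// (lt_trans _ g1).
exists T => // x0; split; first exact: ST.
rewrite leNgt; apply/negP => bad.
have x00 : 0 < enorm x0.
  by apply: le_lt_trans bad; rewrite mulr_ge0 ?(is_norm_ge0 hN)// ltW// (lt_trans _ k1).
(* If [x0] violates the bound, stretching towards it for the norm [N] composed with [T] yields [W],
   and [T *m W] exceeds the supremum. *)
have [||W detW hW] := @stretched_ellipsoid _ _ _ (is_norm_comp hN uT) ST
    ((enorm x0)^-1%:C%C *: x0) k a b _ k1 _ a1 b0 b1 abk.
- by rewrite enormZ nc_nneg ?invr_ge0 ?(ltW x00)// mulVf// lt0r_neq0.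
- rewrite -scalemxAr (is_normZ hN) nc_nneg ?invr_ge0 ?(ltW x00)// mulrCA.
  by rewrite ler_pdivrMl// mulr1 ltW.
have : V (nc (\det (T *m W))) by exists (T *m W) => // x; rewrite -mulmxA hW.
move=> /(ub_le_sup (proj2 hsup)); rewrite det_mulmx ncM detW leNgt.
by rewrite -ltr_pdivrMr ?(lt_trans _ g1)// hT.
Qed.

(** * Operator norms and norms of sets of products *)

Section OperatorNorm.
Variables (R : realType) (d : nat) (N : 'cV[R[i]]_d -> R).
Hypothesis hN : is_norm N.
Implicit Types (A B : 'M[R[i]]_d) (AA : set 'M[R[i]]_d) (v : 'cV[R[i]]_d).

Let opset A := [set N (A *m v) | v in [set v | N v <= 1]].

Let opset0 A : opset A 0.
Proof. by exists 0; rewrite /= ?mulmx0 (is_norm0 hN). Qed.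

Let opset_ub A : has_ubound (opset A).
Proof.
have [c c0 hc] := enorm_le_norm hN; have [K K0 hK] := norm_le_enorm hN.
exists (K * (Num.sqrt (fro2 A) * c^-1)) => _ [v /= v1 <-].
apply: le_trans (hK _) _; rewrite ler_wpM2l//.
apply: le_trans (enorm_mulmx _ _) _; rewrite ler_wpM2l ?sqrtr_ge0//.
by rewrite -[c^-1]mulr1 ler_pdivlMl//; apply: le_trans v1.
Qed.

Lemma opnorm_ge0 A : 0 <= opnorm N A.
Proof. by apply: ub_le_sup (opset0 A); exact: opset_ub. Qed.

Lemma opnormP A v : N (A *m v) <= opnorm N A * N v.
Proof.
have [/(is_norm_eq0 hN) ->|Nv0] := eqVneq (N v) 0.
  by rewrite mulmx0 (is_norm0 hN) mulr0.
have Nvp : 0 < N v by rewrite lt_neqAle eq_sym Nv0 (is_norm_ge0 hN).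
have : opset A (N (A *m ((N v)^-1%:C%C *: v))).
  exists ((N v)^-1%:C%C *: v) => //=.
  by rewrite (is_normZ hN) nc_nneg ?invr_ge0 ?(ltW Nvp)// mulVf.
move=> /(ub_le_sup (opset_ub A)).
rewrite -scalemxAr (is_normZ hN) nc_nneg ?invr_ge0 ?(ltW Nvp)// ler_pdivrMl//.
by rewrite mulrC.
Qed.

Lemma opnorm_le A a : 0 <= a -> (forall v, N (A *m v) <= a * N v) -> opnorm N A <= a.
Proof.
move=> a0 h; apply: ge_sup; first by exists 0; exact: opset0.
by move=> _ [v /= v1 <-]; apply: le_trans (h v) _; rewrite ler_piMr.
Qed.

Lemma opnormM A B : opnorm N (A *m B) <= opnorm N A * opnorm N B.
Proof.
apply: opnorm_le => [|v]; first by rewrite mulr_ge0 ?opnorm_ge0.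
rewrite -mulmxA -mulrA; apply: le_trans (opnormP _ _) _.
by rewrite ler_wpM2l ?opnorm_ge0 ?opnormP.
Qed.

Lemma setnorm_ge0 AA : 0 <= setnorm N AA.
Proof.
(* For an empty or unbounded set the supremum has the default value 0. *)
have [[A0 AA0]|/set0P/negP/negPn/eqP->] := pselect (AA !=set0); last first.
  by rewrite /setnorm image_set0 sup0.
have [ub|nub] := pselect (mxbounded N AA).
  by apply: le_trans (opnorm_ge0 A0) _; apply: ub_le_sup => //; exists A0.
by rewrite /setnorm sup_out// => -[].
Qed.

Lemma opnorm_le_setnorm AA A : mxbounded N AA -> AA A -> opnorm N A <= setnorm N AA.
Proof. by move=> ub AA_A; apply: ub_le_sup => //; exists A. Qed.

Lemma setnorm_le AA a : AA !=set0 -> (forall A, AA A -> opnorm N A <= a) ->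
  setnorm N AA <= a.
Proof.
move=> [A0 AA0] h; apply: ge_sup; first by exists (opnorm N A0); exists A0.
by move=> _ [A AA_A <-]; exact: h.
Qed.

Lemma mxprods1 AA : mxprods AA 1 = AA.
Proof.
apply/seteqP; split=> [_ [A AA_A [_ -> <-]]|A AA_A]; first by rewrite mulmx1.
by exists A => //; exists 1%:M; rewrite ?mulmx1.
Qed.

Lemma mxprodsD AA m n :
  mxprods AA (m + n) = [set A *m B | A in mxprods AA m & B in mxprods AA n].
Proof.
elim: m => [|m IH]; apply/seteqP; split.
- by move=> B hB; exists 1%:M => //; exists B; rewrite ?mul1mx.
- by move=> _ [_ -> [B hB <-]]; rewrite mul1mx.
- move=> _ [A AA_A [C hC <-]]; move: hC; rewrite -/(mxprods AA (m + n)) IH.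
  move=> [B1 h1 [B2 h2 <-]].
  by exists (A *m B1); [exists A => //; exists B1|exists B2; rewrite ?mulmxA].
- move=> _ [_ [A AA_A [B1 h1 <-]] [B2 h2 <-]].
  exists A => //; exists (B1 *m B2); last by rewrite mulmxA.
  by rewrite -/(mxprods AA (m + n)) IH; exists B1 => //; exists B2.
Qed.

Lemma mxprodsM AA m n : mxprods (mxprods AA m) n = mxprods AA (n * m).
Proof. by elim: n => //= n IH; rewrite mulSn mxprodsD IH. Qed.

Lemma mxprods_neq0 AA n : AA !=set0 -> mxprods AA n !=set0.
Proof.
move=> [A AA_A]; elim: n => [|n [B hB]]; first by exists 1%:M.
by exists (A *m B); exists A => //; exists B.
Qed.

Lemma mxprods_bounded AA n : mxbounded N AA -> mxbounded N (mxprods AA n).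
Proof.
move=> ub; elim: n => [|n [M hM]].
  by exists (opnorm N 1%:M) => _ [A -> <-].
exists (setnorm N AA * M) => _ [_ [A AA_A [B hB <-]] <-].
apply: le_trans (opnormM _ _) _; apply: ler_pM; rewrite ?opnorm_ge0//.
  exact: opnorm_le_setnorm.
by apply: hM; exists B.
Qed.

Lemma setnorm_mxprodsD AA m n : AA !=set0 -> mxbounded N AA ->
  setnorm N (mxprods AA (m + n)) <= setnorm N (mxprods AA m) * setnorm N (mxprods AA n).
Proof.
move=> AA0 ub; apply: setnorm_le; first exact: mxprods_neq0.
rewrite mxprodsD => _ [A hA [B hB <-]]; apply: le_trans (opnormM _ _) _.
by apply: ler_pM; rewrite ?opnorm_ge0 ?opnorm_le_setnorm//; exact: mxprods_bounded.
Qed.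

End OperatorNorm.

(** * Simultaneous diagonalization of two norms up to a constant *)

Section SimultaneousAxes.
Variable R : realType.
Local Notation "M ^t*" := (map_mx Num.conj M^T) (at level 30).

Lemma sqn_mulmx (d : nat) (G : 'M[R[i]]_d) x :
  (sqn (G *m x))%:C%C = (x^t* *m (G^t* *m G) *m x) 0 0.
Proof. by rewrite sqnE hdotE trmx_mul map_mxM !mulmxA. Qed.

(** The spectral theorem for the Hermitian matrix [H] gives the unitary matrix [P]; [U] is its
    inverse and [D] collects the squared singular values of [G]. *)
Lemma svd (d : nat) (G : 'M[R[i]]_d) : G \in unitmx ->
  exists U : 'M[R[i]]_d, exists D : 'I_d -> R,
  [/\ U \in unitmx, forall x, enorm (U *m x) = enorm x, forall i, 0 < D i
    & forall x, sqn (G *m (U *m x)) = \sum_i D i * nc (x i 0) ^+ 2].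
Proof.
move=> uG; pose H := G^t* *m G; pose P := spectralmx H.
have hH : H \is hermsymmx.
  apply/is_hermitianmxP; rewrite expr0 scale1r trmx_mul map_mxM.
  by rewrite trmxCK.
have unitP : P \is unitarymx by exact: spectral_unitarymx.
have uP : P \in unitmx by exact: unitarymx_unit.
have HE : H = invmx P *m diag_mx (spectral_diag H) *m P := orthomx_spectralP (hermitian_normalmx hH).
have UP : (invmx P)^t* = P by rewrite invmx_unitary// trmxCK.
(* Taken as squared lengths, these are real and nonnegative from the start; they are then identified
   with the complex spectral values. *)
pose D i := sqn (G *m (invmx P *m (delta_mx i 0 : 'cV[R[i]]_d))).
have sqnGU (x : 'cV[R[i]]_d) : (sqn (G *m (invmx P *m x)))%:C%C =
    \sum_i spectral_diag H 0 i * (nc (x i 0) ^+ 2)%:C%C.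
  have E : (G *m invmx P)^t* *m (G *m invmx P) = diag_mx (spectral_diag H).
    rewrite trmx_mul map_mxM UP -mulmxA (mulmxA _ G) -/H {1}HE -!mulmxA.
    by rewrite (mulKVmx uP) mulmxV// mulmx1.
  rewrite mulmxA sqn_mulmx E -mulmxA.
  rewrite mxE; apply: eq_bigr => i _.
  rewrite mul_diag_mx mxE !mxE sqr_nc.
  by rewrite mulrCA.
have DE i : spectral_diag H 0 i = (D i)%:C%C.
  rewrite sqnGU (bigD1 i)//= big1 => [|j ji]; last first.
    by rewrite mxE (negbTE ji) nc0 expr0n mulr0.
  by rewrite mxE !eqxx nc1 expr1n mulr1 addr0.
exists (invmx P), D; split.
- by rewrite unitmx_inv.
- move=> x; rewrite /enorm; congr Num.sqrt; apply: complexI.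
  by rewrite sqn_mulmx UP (mulmxV uP) mulmx1 -hdotE -sqnE.
- move=> i; rewrite lt_neqAle sqn_ge0 andbT eq_sym; apply/negP => /eqP Di0.
  pose e := delta_mx i 0 : 'cV[R[i]]_d.
  have Z : G *m (invmx P *m e) = 0.
    by apply: enorm_eq0; rewrite /enorm -/(D i) Di0 sqrtr0.
  have : e = 0 by rewrite -[e](mulKVmx uP) -[invmx P *m e](mulKmx uG) Z !mulmx0.
  by move=> /colP/(_ i)/eqP; rewrite !mxE !eqxx oner_eq0.
- move=> x; apply: complexI; rewrite sqnGU rmorph_sum; apply: eq_bigr => i _.
  by rewrite DE -rmorphM.
Qed.

(** [T] and [S] make [N] and [M] Euclidean up to [k]. The isometry [U] from the singular value
    decomposition of [invmx S *m T] keeps the first Euclidean norm and diagonalizes the second. *)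
Lemma simultaneous_axes (d : nat) (N M : 'cV[R[i]]_d -> R) (k : R) :
    is_norm N -> is_norm M -> (0 < d)%N -> 1 < k -> d%:R < k ^+ 2 ->
  exists Q : 'M[R[i]]_d, exists D : 'I_d -> R,
  [/\ Q \in unitmx, forall i, 0 < D i,
      forall x, N (Q *m x) <= enorm x /\ enorm x <= k * N (Q *m x)
    & forall x, M (Q *m x) ^+ 2 <= \sum_i D i * nc (x i 0) ^+ 2 /\
                \sum_i D i * nc (x i 0) ^+ 2 <= (k * M (Q *m x)) ^+ 2].
Proof.
move=> hN hM d0 k1 dk.
have [T uT hT] := john_approx hN d0 k1 dk.
have [S uS hS] := john_approx hM d0 k1 dk.
have uG : invmx S *m T \in unitmx by rewrite unitmx_mul unitmx_inv uS.
have [U [D [uU hU D0 hD]]] := svd uG.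
have k0 : 0 <= k by rewrite ltW// (lt_trans _ k1).
exists (T *m U), D; split => // [|x|x]; first by rewrite unitmx_mul uT.
  by rewrite -mulmxA -hU.
have -> : T *m U *m x = S *m (invmx S *m T *m (U *m x)).
  by rewrite !mulmxA mulmxV// mul1mx.
rewrite -hD -sqr_enorm; have [h1 h2] := hS (invmx S *m T *m (U *m x)).
by rewrite !ler_sqr ?nnegrE ?mulr_ge0 ?enorm_ge0 ?(is_norm_ge0 hM).
Qed.

End SimultaneousAxes.

(** * Adapted norms and Bochi's inequality for general sets *)

Lemma adapted_norm (R : realType) (d : nat) (N : 'cV[R[i]]_d -> R)
    (AA : set 'M[R[i]]_d) (r K : R) :
    is_norm N -> AA !=set0 -> mxbounded N AA -> 0 < r ->
    (forall n, setnorm N (mxprods AA n) <= K * r ^+ n) ->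
  exists2 M : 'cV[R[i]]_d -> R, is_norm M &
    forall A, AA A -> forall v, M (A *m v) <= r * M v.
Proof.
move=> hN AA0 ub r0 hK.
(* The supremum over all products [B] is finite by [hK] and at least [N v] by the term [n = 0];
   appending [A] to the product costs one factor [r]. *)
pose X v := [set x | exists n, exists2 B, mxprods AA n B & x = N (B *m v) / r ^+ n].
pose M v := sup (X v).
have X0 v : X v (N v) by exists 0; exists 1%:M; rewrite // mul1mx expr0 divr1.
have Xub v : ubound (X v) (K * N v).
  move=> _ [n [B hB ->]]; rewrite ler_pdivrMr ?exprn_gt0// mulrAC.
  apply: le_trans (opnormP hN _ _) _; rewrite ler_wpM2r ?(is_norm_ge0 hN)//.
  by apply: le_trans (hK n); apply: opnorm_le_setnorm => //; exact: mxprods_bounded.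
have leM v x : X v x -> x <= M v by move=> h; apply: ub_le_sup => //; exists (K * N v).
have Mle v x : ubound (X v) x -> M v <= x by move=> h; apply: ge_sup => //; exists (N v).
exists M.
  split=> [v|v Mv0|a v|u v].
  - by apply: le_trans (leM v _ (X0 v)); exact: is_norm_ge0.
  - apply: (is_norm_eq0 hN); apply/eqP; rewrite eq_le (is_norm_ge0 hN) andbT -Mv0.
    exact: leM.
  - have H b w : M (b *: w) <= nc b * M w.
      apply: Mle => _ [n [B hB ->]].
      rewrite -scalemxAr (is_normZ hN) -mulrA ler_wpM2l ?nc_ge0//.
      by apply: leM; exists n; exists B.
    (* For nonzero [a] the reverse inequality is the same one applied to [a^-1]. *)
    apply/eqP; rewrite eq_le H /=; have [->|a0] := eqVneq a 0.
      rewrite nc0 mul0r scale0r; apply: le_trans (leM _ _ (X0 0)).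
      exact: is_norm_ge0.
    have nca : 0 < nc a.
      rewrite lt_neqAle nc_ge0 andbT eq_sym; apply: contra_neq a0.
      exact: ComplexField.Normc.eq0_normc.
    have := H a^-1 (a *: v); rewrite scalerA mulVf// scale1r.
    by rewrite ComplexField.Normc.normcV -ler_pdivlMl ?invr_gt0// invrK.
  - apply: Mle => _ [n [B hB ->]]; rewrite mulmxDr.
    apply: (@le_trans _ _ (N (B *m u) / r ^+ n + N (B *m v) / r ^+ n)).
      by rewrite -mulrDl ler_wpM2r ?(is_norm_triangle hN)// invr_ge0 exprn_ge0// ltW.
    by apply: lerD; apply: leM; exists n; exists B.
move=> A AA_A v; apply: Mle => _ [n [B hB ->]].
rewrite mulmxA -ler_pdivrMl//; apply: leM; exists n.+1; exists (B *m A).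
  by rewrite -addn1 mxprodsD; exists B => //; exists A => //; rewrite mxprods1.
by rewrite exprS; field; rewrite !lt0r_neq0 ?exprn_gt0.
Qed.

Lemma mxprods_conj (R : realType) (d : nat) (Q : 'M[R[i]]_d) (AA : set 'M[R[i]]_d) n B :
  Q \in unitmx -> mxprods AA n B ->
  mxprods [set invmx Q *m A *m Q | A in AA] n (invmx Q *m B *m Q).
Proof.
move=> uQ; elim: n B => [|n IH] B; first by move=> ->; rewrite /= mulmx1 mulVmx.
move=> [A AA_A [C hC <-]]; exists (invmx Q *m A *m Q); first by exists A.
exists (invmx Q *m C *m Q); first exact: IH.
by rewrite -!mulmxA (mulKVmx uQ).
Qed.

Section BochiInequality.
Variables (R : realType) (d : nat) (N : 'cV[R[i]]_d -> R) (AA : set 'M[R[i]]_d).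
Variables (r K : R).
Hypotheses (d0 : (0 < d)%N) (hN : is_norm N) (AA0 : AA !=set0)
  (ub : mxbounded N AA) (r0 : 0 < r).
Hypothesis hK : forall n, setnorm N (mxprods AA n) <= K * r ^+ n.

(** In the coordinates [Q], [N] bounds whole matrices by [k * a] and [M] bounds their [upp] parts by
    a multiple of [r]. Every surviving term of a product of length [d] has one [upp] factor, whence
    one [r] and [d.-1] factors [a]. *)
Lemma bochi_approx (k : R) : 1 < k -> d%:R < k ^+ 2 ->
  setnorm N (mxprods AA d) <= k ^+ d.+1 *
    (Num.sqrt d%:R * (\sum_(i < d) Num.sqrt d.-1%:R ^+ i) * r * setnorm N AA ^+ d.-1).
Proof.
move=> k1 dk; have [M hM Mr] := adapted_norm hN AA0 ub r0 hK.
have [Q [D [uQ D0 hNQ hMQ]]] := simultaneous_axes hN hM d0 k1 dk.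
have k0 : 0 < k by exact: lt_trans k1.
set S := \sum_(i < d) _; set a := setnorm N AA.
have S0 : 0 <= S by apply: sumr_ge0 => i _; rewrite exprn_ge0 ?sqrtr_ge0.
have a0 : 0 <= a by exact: setnorm_ge0.
apply: setnorm_le; first exact: mxprods_neq0.
move=> B hB; apply: (opnorm_le hN); first by rewrite !mulr_ge0 ?exprn_ge0 ?sqrtr_ge0 ?(ltW k0) ?(ltW r0).
have QK (A : 'M[R[i]]_d) (x : 'cV[R[i]]_d) : Q *m (invmx Q *m A *m Q *m x) = A *m (Q *m x).
  by rewrite -!mulmxA mulKVmx.
pose AQ := [set invmx Q *m A *m Q | A in AA].
have hAQ A' : AQ A' -> forall x, enorm (A' *m x) <= k * a * enorm x.
  move=> [A AA_A <-] x; apply: le_trans (proj2 (hNQ _)) _.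
  rewrite QK -mulrA ler_wpM2l ?(ltW k0)//; apply: le_trans (opnormP hN _ _) _.
  apply: ler_pM; rewrite ?(opnorm_ge0 hN) ?(is_norm_ge0 hN)//.
    exact: opnorm_le_setnorm.
  exact: (proj1 (hNQ x)).
have hup A' : AQ A' -> fro2 (upp D A') <= (Num.sqrt d%:R * k * r) ^+ 2.
  move=> [A AA_A <-]; set A1 := invmx Q *m A *m Q.
  (* Entries kept in [upp] have [D j <= D i], so [D j] times the squared column is at most its
     weighted square; this is compared with [M], contracted by [r], and compared back on a basis
     vector of weight [D j]. *)
  have hcol j : sqn (col j (upp D A1)) <= (k * r) ^+ 2.
    rewrite -(ler_pM2l (D0 j)).
    apply: (@le_trans _ _ (\sum_i D i * nc (col j A1 i 0) ^+ 2)).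
      rewrite mulr_sumr; apply: ler_sum => i _; rewrite !mxE.
      by case: ifP => h; rewrite ?ler_wpM2r ?sqr_ge0// nc0 expr0n mulr0 mulr_ge0 ?sqr_ge0 ?ltW.
    apply: le_trans (proj2 (hMQ _)) _; rewrite colE QK.
    apply: (@le_trans _ _ ((k * (r * M (Q *m delta_mx j 0))) ^+ 2)).
      rewrite ler_sqr ?nnegrE ?mulr_ge0 ?(is_norm_ge0 hM) ?(ltW k0) ?(ltW r0)//.
      by rewrite ler_wpM2l ?(ltW k0)// Mr.
    rewrite mulrA exprMn mulrC ler_wpM2r ?sqr_ge0//.
    apply: le_trans (proj1 (hMQ _)) _.
    rewrite (bigD1 j)//= big1 => [|i ij].
      by rewrite mxE !eqxx nc1 expr1n mulr1 addr0.
    by rewrite mxE (negbTE ij) nc0 expr0n mulr0.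
  rewrite fro2_cols; apply: le_trans (ler_sum _ (fun j _ => hcol j)) _.
  by rewrite sumr_const card_ord -mulrA [leRHS]exprMn sqr_sqrtr ?ler0n// mulr_natl.
have ka0 : 0 <= k * a by rewrite mulr_ge0 ?(ltW k0).
have u0 : 0 <= Num.sqrt d%:R * k * r.
  by rewrite !mulr_ge0 ?sqrtr_ge0 ?(ltW k0) ?(ltW r0).
move=> v; have := enorm_mxprods ka0 u0 d0 hAQ hup (mxprods_conj uQ hB) (invmx Q *m v).
rewrite -/S => h; apply: le_trans (_ : enorm (invmx Q *m B *m Q *m (invmx Q *m v)) <= _).
  by apply: le_trans (proj1 (hNQ _)); rewrite QK mulKVmx.
apply: le_trans h _.
have := proj2 (hNQ (invmx Q *m v)); rewrite mulKVmx// => hv.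
(* The factors [k] number [d.+1]: one from [upp], [d.-1] from [k * a], and one from the return to
   [N]. *)
apply: (@le_trans _ _ (Num.sqrt d%:R * k * r * (k * a) ^+ d.-1 * S * (k * N v))).
  by rewrite ler_wpM2l// (mulr_ge0 _ S0)// (mulr_ge0 u0)// exprn_ge0.
rewrite exprMn le_eqVlt; apply/orP; left; apply/eqP.
have -> : k ^+ d.+1 = k ^+ d.-1 * k ^+ 2 by rewrite -exprD addn2 prednK.
rewrite -/a; move: (k ^+ d.-1) (a ^+ d.-1) => x y; ring.
Qed.

End BochiInequality.

(** Termwise comparison with the binomial expansion of the right-hand side. *)
Lemma geometric_sqrt_le (R : realType) (n : nat) :
  \sum_(i < n.+1) Num.sqrt n%:R ^+ i <= n.+1%:R ^+ n :> R.
Proof.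
have [->|n0] := posnP n; first by rewrite big_ord1 !expr0.
have n1 : 1 <= n%:R :> R by rewrite ler1n.
rewrite -natr1 addrC exprDn; apply: ler_sum => i _.
rewrite expr1n mul1r; apply: (@le_trans _ _ (n%:R ^+ i)).
  apply: lerXn2r; rewrite ?nnegrE ?sqrtr_ge0 ?ler0n//.
  rewrite -[leRHS]sqr_sqrtr ?ler0n// expr2 ler_peMl ?sqrtr_ge0//.
  by rewrite -[leLHS]sqrtr1 ler_wsqrtr.
rewrite -[leRHS]mulr_natr ler_peMr ?exprn_ge0 ?ler0n// ler1n bin_gt0.
by rewrite -ltnS.
Qed.

(** Serves to let [k] decrease to the square root of [d], and later [r] to the joint spectral
    radius. *)
Lemma expr_le_of_gt (R : realType) (n : nat) (q X Y : R) :
  (forall k, q < k -> X <= k ^+ n * Y) -> X <= q ^+ n * Y.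
Proof.
move=> h.
have cf : (k ^+ n * Y @[k --> q^'+] --> q ^+ n * Y)%classic.
  apply: cvgMl; apply: cvg_at_right_filter; exact: exprn_continuous.
apply: (cvgr_to_ge cf); near=> k; exact: h.
Unshelve. all: by end_near.
Qed.

Lemma expr_bounded_le1 (R : realType) (x K : R) : 0 <= x ->
  (forall n, x ^+ n <= K) -> x <= 1.
Proof.
move=> x0 h; rewrite leNgt; apply/negP => x1.
have xK n : n%:R * (x - 1) <= x ^+ n.
  elim: n => [|n IH]; first by rewrite mul0r.
  have : 1 <= x ^+ n by rewrite exprn_ege1// ltW.
  by rewrite exprS -natr1; move: (x ^+ n) IH => y; nra.
have := archi_boundP (_ : 0 <= `|K| / (x - 1)); rewrite divr_ge0 ?subr_ge0 ?(ltW x1)//.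
move=> /(_ isT); rewrite ltr_pdivrMr ?subr_gt0// ltNge => /negP; apply.
by apply: le_trans (xK _) _; apply: le_trans (h _) (ler_norm _).
Qed.

Section Bochi.
Variables (R : realType) (d : nat) (N : 'cV[R[i]]_d -> R) (AA : set 'M[R[i]]_d).
Variables (r K : R).
Hypotheses (d2 : (2 <= d)%N) (hN : is_norm N) (AA0 : AA !=set0)
  (ub : mxbounded N AA) (r0 : 0 < r).
Hypothesis hK : forall n, setnorm N (mxprods AA n) <= K * r ^+ n.

Lemma bochi_general : setnorm N (mxprods AA d) <=
  d%:R `^ (3 * d%:R / 2) * r * setnorm N AA ^+ d.-1.
Proof.
have d0 : (0 < d)%N by exact: ltnW.
set a := setnorm N AA; set q : R := Num.sqrt d%:R.
have a0 : 0 <= a by exact: setnorm_ge0.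
have q1 : 1 < q by rewrite -[ltLHS]sqrtr1 ltr_sqrt ?ltr0n// ltr1n.
have q2 : q ^+ 2 = d%:R by rewrite sqr_sqrtr.
pose S : R := \sum_(i < d) Num.sqrt d.-1%:R ^+ i.
(* The [3 * d] powers of [q]: [d.+1] from the limit of the factors [k], one from [Num.sqrt d%:R],
   and [2 * d.-1] from the bound [d%:R ^+ d.-1] of the geometric sum. *)
have qE : d%:R `^ (3 * d%:R / 2) = q ^+ d.+1 * (q * q ^+ (2 * d.-1)) :> R.
  rewrite -exprS -exprD (_ : (d.+1 + (2 * d.-1).+1 = 3 * d)%N); last first.
    by case: d d0 => // n _ /=; rewrite mulnS; lia.
  rewrite -powR_mulrn ?sqrtr_ge0// /q -powR12_sqrt ?ler0n// -powRrM.
  by congr (_ `^ _); rewrite natrM; field.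
apply: (@le_trans _ _ (q ^+ d.+1 * (q * S * r * a ^+ d.-1))).
  apply: expr_le_of_gt => k qk; apply: (bochi_approx d0 hN AA0 ub r0 hK).
    exact: lt_trans qk.
  by rewrite -q2 ltr_sqr ?nnegrE ?sqrtr_ge0// ltW// (le_lt_trans _ qk) ?sqrtr_ge0.
rewrite qE -!mulrA ler_wpM2l ?exprn_ge0 ?sqrtr_ge0// ler_wpM2l ?sqrtr_ge0//.
rewrite ler_wpM2r ?mulr_ge0 ?exprn_ge0 ?(ltW r0)// exprM q2.
by have := @geometric_sqrt_le R d.-1; rewrite /S prednK.
Qed.

End Bochi.

(** * Bochi's inequality for a single matrix *)

Section BochiSingle.
Variables (R : realType) (d' : nat).
Local Notation d := d'.+1.
Variables (N : 'cV[R[i]]_d -> R) (A : 'M[R[i]]_d).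
Hypothesis hN : is_norm N.
Local Notation a := (opnorm N A).

Lemma mxprods_set1 n : mxprods [set A] n = [set A ^+ n].
Proof.
elim: n => [|n IH] //=; rewrite IH; apply/seteqP; split.
  by move=> _ [_ -> [_ -> <-]]; rewrite exprS.
by move=> _ ->; exists A => //; exists (A ^+ n); rewrite ?exprS.
Qed.

Lemma setnorm_set1 (B : 'M[R[i]]_d) : setnorm N [set B] = opnorm N B.
Proof. by rewrite /setnorm image_set1 sup1. Qed.

Lemma opnormX n : opnorm N (A ^+ n) <= a ^+ n.
Proof.
elim: n => [|n IH].
  by rewrite !expr0; apply: opnorm_le => // v; rewrite mul1mx mul1r.
by rewrite !exprS; apply: le_trans (opnormM hN _ _) _; rewrite ler_wpM2l ?opnorm_ge0.
Qed.

(** The difference is [A (P - B) - z (P - B) - z B]; [z] is bounded by [a] in the middle term and by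
    [mu] in the last. *)
Lemma prod_shift_step (mu : R) (z : R[i]) (P B : 'M[R[i]]_d) v :
    nc z <= mu -> mu <= a ->
  N (((A - z%:M) *m P - A *m B) *m v) <=
    2 * (a * N ((P - B) *m v)) + mu * N (B *m v).
Proof.
move=> zmu mua.
have -> : ((A - z%:M) *m P - A *m B) *m v =
    A *m ((P - B) *m v) + (- (z *: ((P - B) *m v)) + - (z *: (B *m v))).
  rewrite !mulmxBl !mul_scalar_mx !mulmxBr -!scalemxAl -!mulmxA scalerBr opprB.
  by rewrite (addrAC (z *: (B *m v))) subrr add0r addrAC.
apply: le_trans (is_norm_triangle hN _ _) _.
apply: (@le_trans _ _ (a * N ((P - B) *m v) +
    (a * N ((P - B) *m v) + mu * N (B *m v)))); last by lra.
apply: lerD; first exact: opnormP.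
apply: le_trans (is_norm_triangle hN _ _) _.
rewrite !(is_normN hN) !(is_normZ hN).
by apply: lerD; rewrite ler_wpM2r ?(is_norm_ge0 hN)// (le_trans zmu).
Qed.

(** Of the [2 ^+ size s] terms of the expanded product, all but [A ^+ size s] contain some [z]. The
    factor [a] on the left avoids the exponent [size s - 1] and a division by [a]. *)
Lemma prod_shift_le (mu : R) (s : seq R[i]) v :
    0 <= mu -> mu <= a -> (forall z, z \in s -> nc z <= mu) ->
  a * N ((\prod_(z <- s) (A - z%:M) - A ^+ size s) *m v) <=
    (2 ^+ size s - 1) * mu * a ^+ size s * N v.
Proof.
move=> mu0 mua; elim: s => [|z s IH] hs.
  by rewrite big_nil subrr mul0mx (is_norm0 hN) mulr0 subrr !mul0r.
have {}IH := IH (fun y ys => hs y (@mem_behead _ (z :: s) y ys)).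
have a0 : 0 <= a by exact: opnorm_ge0.
rewrite big_cons /= !exprS.
have h := prod_shift_step (\prod_(j <- s) (A - j%:M)) (A ^+ size s) v
  (hs z (mem_head _ _)) mua.
have hv : N (A ^+ size s *m v) <= a ^+ size s * N v.
  apply: le_trans (opnormP hN _ _) _.
  by rewrite ler_wpM2r ?(is_norm_ge0 hN)// opnormX.
rewrite (_ : (2 * 2 ^+ size s - 1) * mu * (a * a ^+ size s) * N v =
  a * (2 * ((2 ^+ size s - 1) * mu * a ^+ size s * N v) +
    mu * (a ^+ size s * N v))); last by ring.
rewrite ler_wpM2l//; apply: le_trans h _.
by apply: lerD; rewrite ler_wpM2l.
Qed.

(** Powers of [A] on an eigenvector show that [nc z / r] has bounded powers. *)
Lemma char_root_le (r K : R) z : 0 < r -> (forall n, opnorm N (A ^+ n) <= K * r ^+ n) ->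
  root (char_poly A) z -> nc z <= r.
Proof.
(* Eigenvectors come as row vectors; the transpose turns them into columns. *)
move=> r0 hK; have -> : char_poly A = char_poly A^T.
  rewrite /char_poly -det_tr; congr (\det _).
  by rewrite /char_poly_mx linearB /= tr_scalar_mx map_trmx.
rewrite -eigenvalue_root_char.
move=> /eigenvalueP[u uA u0].
have Av : A *m u^T = z *: u^T by rewrite -[A]trmxK -trmx_mul uA linearZ.
have v0 : 0 < N u^T.
  rewrite lt_neqAle (is_norm_ge0 hN) andbT eq_sym; apply: contra_neq u0.
  by move=> /(is_norm_eq0 hN) h; rewrite -[u]trmxK h trmx0.
rewrite -[leRHS]mul1r -ler_pdivrMr//.
apply: (@expr_bounded_le1 _ _ K); first by rewrite divr_ge0 ?nc_ge0// ltW.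
move=> n; rewrite expr_div_n ler_pdivrMr ?exprn_gt0//; apply: le_trans (hK n).
have Anv : A ^+ n *m u^T = z ^+ n *: u^T.
  elim: n => [|n IH]; first by rewrite !expr0 mul1mx scale1r.
  by rewrite exprS -mulmxA IH -scalemxAr Av scalerA exprSr.
rewrite -(ler_pM2r v0) -ncX -(is_normZ hN) -Anv; exact: opnormP.
Qed.

Lemma bochi_single (r K : R) : 0 < r -> (forall n, opnorm N (A ^+ n) <= K * r ^+ n) ->
  opnorm N (A ^+ d) <= (2 ^+ d - 1) * r * a ^+ d'.
Proof.
move=> r0 hK; have a0 : 0 <= a by exact: opnorm_ge0.
have [s hs] := closed_field_poly_normal (char_poly A).
rewrite (monicP (char_poly_monic A)) scale1r in hs.
have ss : size s = d.
  by have := size_char_poly A; rewrite hs size_prod_XsubC => -[].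
(* The estimate of the shifted product needs roots bounded by [a] as well as by [r]. *)
pose mu := Num.min r a.
have hmu z : z \in s -> nc z <= mu.
  move=> zs; have rz : root (char_poly A) z by rewrite hs root_prod_XsubC.
  rewrite le_min (char_root_le r0 hK rz) /=.
  (* The bound by [a] is the root bound with [a] as [r]. For [a = 0], which is not positive, half
     the modulus of the root is used instead and gives a contradiction. *)
  have [a_0|an0] := eqVneq a 0.
    apply: le_trans (_ : 0 <= _) => //; rewrite leNgt; apply/negP => z0.
    have := @char_root_le (nc z / 2) 1 z.
    rewrite divr_gt0// => /(_ isT) H.
    have : nc z <= nc z / 2.
      apply: H => // n; apply: le_trans (opnormX n) _; rewrite a_0 mul1r expr0n.
      by case: n => [|n]; rewrite ?expr0//= exprn_ge0// ltW// divr_gt0.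
    by lra.
  apply: (@char_root_le a 1) => // [|n]; last by rewrite mul1r opnormX.
  by rewrite lt_neqAle eq_sym an0.
have CH : \prod_(z <- s) (A - z%:M) = 0.
  have := Cayley_Hamilton A; rewrite hs rmorph_prod /= => H.
  rewrite -[RHS]H; apply: eq_bigr => z _.
  by rewrite rmorphB /= horner_mx_X horner_mx_C.
have mu0 : 0 <= mu by rewrite le_min a0 ltW.
have mua : mu <= a by rewrite ge_min lexx orbT.
apply: (@le_trans _ _ ((2 ^+ d - 1) * mu * a ^+ d')); last first.
  rewrite ler_wpM2r ?exprn_ge0// ler_wpM2l ?ge_min ?lexx//.
  by rewrite subr_ge0 exprn_ege1// ler1n.
apply: opnorm_le => //.
  by rewrite mulr_ge0 ?exprn_ge0// mulr_ge0// subr_ge0 exprn_ege1// ler1n.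
move=> v; have -> : N (A ^+ d *m v) = N ((\prod_(z <- s) (A - z%:M) - A ^+ size s) *m v).
  by rewrite CH ss sub0r mulNmx (is_normN hN).
(* One root is peeled off, so that the estimate for the other [d'] roots, already multiplied by [a],
   yields [a ^+ d']. *)
case: s hmu ss {CH hs} => // z s hmu [ss]; rewrite big_cons /= !exprS ss.
have h := prod_shift_step (\prod_(j <- s) (A - j%:M)) (A ^+ d') v
  (hmu z (mem_head _ _)) mua.
have hv : N (A ^+ d' *m v) <= a ^+ d' * N v.
  apply: le_trans (opnormP hN _ _) _.
  by rewrite ler_wpM2r ?(is_norm_ge0 hN)// opnormX.
have := prod_shift_le v mu0 mua (fun y ys => hmu y (@mem_behead _ (z :: s) y ys)).
rewrite ss => h2; apply: le_trans h _.
rewrite (_ : (2 * 2 ^+ d' - 1) * mu * a ^+ d' * N v =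
  2 * ((2 ^+ d' - 1) * mu * a ^+ d' * N v) +
    mu * (a ^+ d' * N v)); last by ring.
by apply: lerD; rewrite ler_wpM2l.
Qed.

End BochiSingle.

(** * Fekete's lemma for submultiplicative sequences *)

Section Fekete.
Variables (R : realType) (u : nat -> R).
Hypothesis u0 : forall n, 0 <= u n.
Hypothesis uD : forall m n, u (m + n)%N <= u m * u n.

(** Division of [n] by [m] with remainder; [K] is a sum over all remainders and so dominates each of
    them. *)
Lemma fekete_bound (r : R) m : (0 < m)%N -> 0 < r -> u m <= r ^+ m ->
  exists K, forall n, u n <= K * r ^+ n.
Proof.
move=> m0 r0 hm; exists (\sum_(s < m) u s / r ^+ s) => n.
have H q s : u (q * m + s) <= (r ^+ m) ^+ q * u s.
  elim: q => [|q IH]; first by rewrite mul0n add0n mul1r.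
  rewrite mulSn -addnA exprS -mulrA; apply: le_trans (uD _ _) _.
  by apply: ler_pM.
rewrite {1}(divn_eq n m); apply: le_trans (H _ _) _.
have sm : (n %% m < m)%N by rewrite ltn_mod.
rewrite (bigD1 (Ordinal sm))//= mulrDl -[leLHS]addr0 lerD//; last first.
  rewrite mulr_ge0 ?exprn_ge0 ?(ltW r0)// sumr_ge0// => i _.
  by rewrite divr_ge0// exprn_ge0// ltW.
rewrite [X in _ <= _ * r ^+ X](divn_eq n m) exprD mulnC exprM le_eqVlt; apply/orP; left; apply/eqP.
by field; rewrite expf_neq0// lt0r_neq0.
Qed.

Lemma root_le_of_bound (K r r' : R) : 0 < r -> r < r' ->
  (forall n, u n <= K * r ^+ n) -> \forall n \near \oo, u n `^ n%:R^-1 <= r'.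
Proof.
move=> r0 rr' h; have r'0 : 0 < r' by exact: lt_trans rr'.
have x1 : 1 < r' / r by rewrite ltr_pdivlMr// mul1r.
(* From the index [n0] on, the powers of [r' / r] absorb the constant [K]. *)
have [n0 hn0] : exists n0, K < (r' / r) ^+ n0.
  apply: contrapT => /forallNP H.
  have : r' / r <= 1.
    apply: (@expr_bounded_le1 _ _ K); first by rewrite divr_ge0// ltW.
    by move=> n; rewrite leNgt; apply/negP; exact: H.
  by rewrite leNgt x1.
near=> n.
have n1 : (0 < n)%N by near: n; exact: nbhs_infty_gt.
have : u n <= r' ^+ n.
  apply: le_trans (h n) _; rewrite -ler_pdivlMr ?exprn_gt0// -expr_div_n.
  apply: le_trans (ltW hn0) _; rewrite ler_eXn2l//.
  by near: n; exact: nbhs_infty_ge.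
move=> /(ge0_ler_powR (_ : 0 <= n%:R^-1)); rewrite !nnegrE invr_ge0 ler0n.
move=> /(_ isT (u0 n)); rewrite exprn_ge0 ?(ltW r'0)// => /(_ isT) H.
apply: le_trans H _; rewrite -powR_mulrn ?(ltW r'0)// -powRrM divff.
  by rewrite powRr1// ltW.
by rewrite pnatr_eq0 -lt0n.
Unshelve. all: by end_near.
Qed.

(** Index 0 is left out: since [0^-1 = 0], its term would be 1 whatever [u] is. *)
Let V := [set u n `^ n%:R^-1 | n in [set n | (0 < n)%N]].

Let V_lb : lbound V 0.
Proof. by move=> _ [n _ <-]; exact: powR_ge0. Qed.

Let V_neq0 : V !=set0.
Proof. by exists (u 1 `^ 1%:R^-1); exists 1%N. Qed.

Lemma inf_root_bound (r : R) : inf V < r -> exists K, forall n, u n <= K * r ^+ n.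
Proof.
move=> hr; have r0 : 0 < r.
  by apply: le_lt_trans hr; apply: lb_le_inf.
have : 0 < r - inf V by rewrite subr_gt0.
move=> /inf_adherent/(_ (conj V_neq0 (ex_intro _ 0 V_lb)))[_ [m m0 <-]].
rewrite addrC subrK => hm; apply: (@fekete_bound r m) => //.
have := ltW hm; move=> /(ge0_ler_powR (ler0n R m)).
rewrite !nnegrE powR_ge0 (ltW r0) => /(_ isT isT).
rewrite -powRrM mulVf ?pnatr_eq0 -?lt0n// powRr1// powR_mulrn//.
exact: ltW.
Qed.

Lemma fekete_cvg : (fun n => u n `^ n%:R^-1) @ \oo --> inf V.
Proof.
apply/cvgrPdist_le => e e0.
have [K hK] : exists K, forall n, u n <= K * (inf V + e / 2) ^+ n.
  by apply: inf_root_bound; rewrite ltrDl divr_gt0.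
have i0 : 0 <= inf V by exact: lb_le_inf.
have p0 : 0 < inf V + e / 2 by rewrite ltr_wpDl// divr_gt0.
have := root_le_of_bound p0 (_ : _ < inf V + e) hK.
rewrite ltrD2l ltr_pdivrMr// mulr_natr mulr2n ltrDl => /(_ e0) H.
near=> n.
have n1 : (0 < n)%N by near: n; exact: nbhs_infty_gt.
have h1 : inf V <= u n `^ n%:R^-1 by apply: ge_inf; [exists 0|exists n].
have h2 : u n `^ n%:R^-1 <= inf V + e by near: n.
by rewrite ler_norml; apply/andP; split; lra.
Unshelve. all: by end_near.
Qed.

Lemma fekete_lim_ge0 : 0 <= limn (fun n => u n `^ n%:R^-1).
Proof. by rewrite (cvg_lim _ fekete_cvg)//; exact: lb_le_inf. Qed.

Lemma fekete_lim_le n : (0 < n)%N -> limn (fun n => u n `^ n%:R^-1) <= u n `^ n%:R^-1.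
Proof.
by move=> n0; rewrite (cvg_lim _ fekete_cvg)//; apply: ge_inf; [exists 0|exists n].
Qed.

Lemma fekete_lim_bound (r : R) : limn (fun n => u n `^ n%:R^-1) < r ->
  exists K, forall n, u n <= K * r ^+ n.
Proof. by rewrite (cvg_lim _ fekete_cvg)//; exact: inf_root_bound. Qed.

End Fekete.

(** * The joint spectral radius and its Bochi inequality *)

Section JointSpectralRadius.
Variables (R : realType) (d : nat) (N : 'cV[R[i]]_d -> R) (AA : set 'M[R[i]]_d).
Hypotheses (d2 : (2 <= d)%N) (hN : is_norm N) (AA0 : AA !=set0)
  (ub : mxbounded N AA).
Local Notation u n := (setnorm N (mxprods AA n)).

Let u0 n : 0 <= u n. Proof. exact: setnorm_ge0. Qed.

Let uD m n : u (m + n)%N <= u m * u n. Proof. exact: setnorm_mxprodsD. Qed.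

Lemma jsr_ge0 : 0 <= jsr N AA.
Proof. exact: fekete_lim_ge0. Qed.

Lemma jsr_le n : (0 < n)%N -> jsr N AA <= u n `^ n%:R^-1.
Proof. exact: (fekete_lim_le u0 uD). Qed.

Lemma jsrX_le n : (0 < n)%N -> jsr N AA ^+ n <= u n.
Proof.
move=> n0; have := jsr_le n0; move=> /(ge0_ler_powR (ler0n R n)).
rewrite !nnegrE powR_ge0 jsr_ge0 => /(_ isT isT).
by rewrite -powRrM mulVf ?pnatr_eq0 -?lt0n// powRr1// powR_mulrn// jsr_ge0.
Qed.

(** Bochi's inequality for the set [mxprods AA m] with rate [r ^+ m], where [r] decreases to the
    radius. The constant may depend on [AA] alone because products from a singleton form a
    singleton. *)
Lemma bochi_jsr m : u (d * m) <= C_const AA * jsr N AA ^+ m * u m ^+ d.-1.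
Proof.
rewrite -[C_const AA * _]mulrC -mulrA; apply: expr_le_of_gt => r hr.
have r0 : 0 < r by apply: le_lt_trans hr; exact: jsr_ge0.
have [K hK] := fekete_lim_bound u0 uD hr.
have hKm n : setnorm N (mxprods (mxprods AA m) n) <= K * (r ^+ m) ^+ n.
  by rewrite mxprodsM -exprM mulnC; exact: hK.
rewrite mulrA [r ^+ m * _]mulrC -mxprodsM /C_const.
case: ifPn => [|_]; last first.
  apply: (bochi_general d2 hN _ _ _ hKm); first exact: mxprods_neq0.
    exact: mxprods_bounded.
  exact: exprn_gt0.
move=> /eq_cardSP[A AA_A]; rewrite II0 card_eq0 => /eqP AAE.
have {}AAE : AA = [set A] by rewrite -(setD1K AA_A) AAE setU0.
case: d d2 N hN AA A ub AA0 AA_A AAE hKm => // d' _ N' hN' AA' A _ _ _ -> hKm.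
move: hKm; rewrite mxprods_set1 => hKm.
have {}hKm n : opnorm N' (A ^+ m ^+ n) <= K * r ^+ m ^+ n.
  by have := hKm n; rewrite mxprods_set1 setnorm_set1.
by rewrite mxprods_set1 !setnorm_set1; apply: bochi_single hKm => //; exact: exprn_gt0.
Qed.

End JointSpectralRadius.

(** * Subadditive functions along base [d] expansions *)

Section Digits.
Variables (R : realType) (d : nat) (L : nat -> R) (c : R).
Local Notation p := d.-1.
Hypotheses (d2 : (2 <= d)%N) (L_0 : L 0%N = 0).
Hypothesis LD : forall m n, L (m + n)%N <= L m + L n.
Hypothesis Lmul : forall m, L (d * m)%N <= c + p%:R * L m.

Lemma subadditive_le_mul n : L n <= n%:R * L 1%N.
Proof.
elim: n => [|n IH]; first by rewrite L_0 mul0r.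
by rewrite -addn1 natrD mulrDl mul1r; apply: le_trans (LD _ _) _; rewrite lerD2r.
Qed.

(** Removing the last digit costs [c], multiplies the bound by [d.-1], and adds at most [d.-1] times
    [L 1]. *)
Lemma digits_bound k n : 0 <= L 1%N -> (n < d ^ k.+1)%N ->
  L n <= (\sum_(i < k) p%:R ^+ i) * c + (\sum_(i < k.+1) p%:R ^+ i.+1) * L 1%N.
Proof.
move=> L1; have d0 : (0 < d)%N by exact: ltnW.
have lt_d s : (s < d)%N -> s%:R * L 1%N <= p%:R * L 1%N.
  by move=> sd; rewrite ler_wpM2r// ler_nat -ltnS prednK.
elim: k n => [|k IH] n hn.
  rewrite big_ord0 mul0r add0r big_ord1 expr1; apply: le_trans (subadditive_le_mul n) _.
  by apply: lt_d; rewrite expn1 in hn.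
have hq : (n %/ d < d ^ k.+1)%N by rewrite ltn_divLR// -expnSr.
rewrite {1}(divn_eq n d) mulnC; apply: le_trans (LD _ _) _.
apply: le_trans (lerD (Lmul _) (subadditive_le_mul _)) _.
have h1 : p%:R * L (n %/ d)%N <= p%:R * ((\sum_(i < k) p%:R ^+ i) * c +
    (\sum_(i < k.+1) p%:R ^+ i.+1) * L 1%N).
  by rewrite ler_wpM2l// IH.
have h2 : (n %% d)%:R * L 1%N <= p%:R * L 1%N by rewrite lt_d// ltn_mod.
apply: le_trans (lerD (lerD (lexx c) h1) h2) _.
(* One recurrence for both coefficients, whose exponents start at 0 and at 1. *)
have E f m : \sum_(i < m.+1) p%:R ^+ (f + i) = p%:R ^+ f + p%:R * \sum_(i < m) p%:R ^+ (f + i) :> R.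
  rewrite big_ord_recl addn0 mulr_sumr; congr (_ + _); apply: eq_bigr => i _.
  by rewrite -exprS /= /bump addnS.
have := E 0%N k; rewrite expr0 => ->.
have := E 1%N k.+1; rewrite expr1 => ->.
by rewrite le_eqVlt; apply/orP; left; apply/eqP; ring.
Qed.

End Digits.

(** * Closed-form bounds for the digit sums *)

Section Exponents.
Variables (R : realType) (d n : nat).
Hypotheses (d2 : (2 <= d)%N) (n1 : (1 <= n)%N).
Local Notation p := d.-1.
Local Notation k := (trunc_log d n).
Local Notation f := (\sum_(i < k) (p%:R : R) ^+ i).
Local Notation g := (\sum_(i < k.+1) (p%:R : R) ^+ i.+1).

Let pE : d%:R - 1 = p%:R :> R.
Proof. by rewrite -[d in LHS]prednK ?(ltnW d2)// -natr1 addrK. Qed.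

Let k_le_ln : k%:R <= ln n%:R / ln d%:R :> R.
Proof.
have lnd : 0 < ln d%:R :> R by rewrite ln_gt0// ltr1n.
rewrite ler_pdivlMr// mulr_natl -lnXn ?ltr0n ?(ltnW d2)//.
rewrite ler_ln ?posrE ?exprn_gt0 ?ltr0n ?(ltnW d2)// -natrX ler_nat.
exact: trunc_logP.
Qed.

Let geometric m : (p%:R - 1) * \sum_(i < m) (p%:R : R) ^+ i = p%:R ^+ m - 1.
Proof. by rewrite -subrX1. Qed.

Let gE : g = p%:R * \sum_(i < k.+1) (p%:R : R) ^+ i.
Proof. by rewrite mulr_sumr; apply: eq_bigr => i _; rewrite exprS. Qed.

Let pX_le : (2 < d)%N -> (p%:R : R) ^+ k <= n%:R `^ (ln (d%:R - 1) / ln d%:R).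
Proof.
move=> d3; have p2 : (1 < p)%N by rewrite -ltnS prednK// ltnW.
have p0 : 0 < p%:R :> R by rewrite ltr0n (ltn_trans _ p2).
rewrite pE -ler_ln ?posrE ?exprn_gt0 ?powR_gt0 ?ltr0n ?(ltn_trans _ p2)//.
rewrite lnXn// ln_powR -[leLHS]mulr_natl.
have -> : ln p%:R / ln d%:R * ln n%:R = ln n%:R / ln d%:R * ln p%:R :> R by ring.
by rewrite ler_wpM2r// ln_ge0// ler1n ltnW.
Qed.

(** For [d = 2] the sum is [k + 1], with [k] at most the logarithm; otherwise it is geometric with
    ratio [d.-1], and its negative term is dropped. *)
Lemma digit_sum_le_nu : g <= nu R d n.
Proof.
rewrite gE /nu; case: eqP => [d_2|/eqP dn2].
  have h := k_le_ln; rewrite d_2 in h *; rewrite mul1r.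
  under eq_bigr do rewrite expr1n.
  by rewrite sumr_const card_ord -[leLHS]natr1 lerD2r.
have d3 : (2 < d)%N by rewrite ltn_neqAle eq_sym dn2.
have P := pX_le d3; have G := geometric k.+1.
have -> : d%:R - 2 = p%:R - 1 :> R by rewrite -pE; ring.
have p1 : 0 < p%:R - 1 :> R by rewrite subr_gt0 ltr1n -ltnS prednK// ltnW.
rewrite pE in P *; set y := n%:R `^ _ in P *.
rewrite -(ler_pM2l p1) mulrCA G exprS.
rewrite [leRHS](_ : _ = p%:R * (p%:R * y)); last by field; exact: lt0r_neq0.
rewrite ler_wpM2l//; apply: (@le_trans _ _ (p%:R * p%:R ^+ k)); last by rewrite ler_wpM2l.
by rewrite lerBlDr lerDl.
Qed.

Lemma digit_sums_le_sigma : f + g <= sigma R d n.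
Proof.
rewrite gE /sigma; case: eqP => [d_2|/eqP dn2].
  have h := k_le_ln; rewrite d_2 in h *; rewrite mul1r.
  under eq_bigr do rewrite expr1n; under [X in _ + X]eq_bigr do rewrite expr1n.
  rewrite !sumr_const !card_ord -[(trunc_log 2 n).+1%:R]natr1.
  (* Here the left side is [2 * k + 1], and [(k + 1) * (k + 2) / 2] exceeds it by [k * (k - 1) / 2],
     which is nonnegative because [k] is an integer. *)
  have k0 : (trunc_log 2 n)%:R * ((trunc_log 2 n)%:R - 1) >= 0 :> R.
    case: (trunc_log 2 n) => [|m]; first by rewrite mul0r.
    by rewrite mulr_ge0// -natr1 addrK.
  have k1 : 0 <= (trunc_log 2 n)%:R :> R by rewrite ler0n.
  by move: h k0 k1; set x := ln _ / _; move: (_%:R) => z h k0 k1; nra.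
have d3 : (2 < d)%N by rewrite ltn_neqAle eq_sym dn2.
have P := pX_le d3; have G := geometric k.+1; have F := geometric k.
have -> : d%:R - 2 = p%:R - 1 :> R by rewrite -pE; ring.
have p1 : 0 < p%:R - 1 :> R by rewrite subr_gt0 ltr1n -ltnS prednK// ltnW.
rewrite pE in P *; set y := n%:R `^ _ in P *.
have y0 : 0 <= y by exact: powR_ge0.
rewrite -(ler_pM2l p1) mulrDr F mulrCA G exprS.
set q : R := p%:R in P p1 *; set t := q ^+ k in P *.
have -> : (q - 1) * (q ^+ 3 / (q - 1) ^+ 2 * y) = q ^+ 3 * y / (q - 1).
  by field; exact: lt0r_neq0.
(* After multiplication by [q - 1] the sums are at most [(1 + q ^+ 2) * t], and
   [(1 + q ^+ 2) * (q - 1) <= q ^+ 3]. *)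
apply: (@le_trans _ _ ((1 + q ^+ 2) * y)).
  apply: (@le_trans _ _ ((1 + q ^+ 2) * t)).
    have q0 : 0 <= q by rewrite ler0n.
    by lra.
  by rewrite ler_wpM2l// addr_ge0// sqr_ge0.
rewrite ler_pdivlMr//.
have -> : q ^+ 3 * y = (1 + q ^+ 2) * y * (q - 1) + (q * (q - 1) + 1) * y by ring.
by rewrite lerDl mulr_ge0// addr_ge0// mulr_ge0 ?ler0n// ltW.
Qed.

End Exponents.

(** * Two-sided bounds for the joint spectral radius *)

Lemma C_const_ge1 (R : realType) (d : nat) (AA : set 'M[R[i]]_d) :
  (2 <= d)%N -> 1 <= C_const AA.
Proof.
move=> d2; rewrite /C_const; case: ifP => _.
  have : 2 ^+ 1 <= 2 ^+ d :> R by rewrite ler_eXn2l ?ltr1n// ltnW.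
  by rewrite expr1; lra.
by rewrite -[leLHS](powRr0 d%:R) ler_powR// ?ler1n ?divr_ge0 ?mulr_ge0// ltnW.
Qed.

Theorem theorem1 (R : realType) (d : nat) (hd : (2 <= d)%N)
    (N : 'cV[R[i]]_d -> R) (hN : is_norm N)
    (AA : set 'M[R[i]]_d) (hS0 : AA !=set0) (hSb : mxbounded N AA)
    (hrho : jsr N AA <> 0) (n : nat) (hn : (1 <= n)%N) :
  C_const AA `^ (- (sigma R d n / n%:R))
    * (setnorm N AA ^+ d / setnorm N (mxprods AA d)) `^ (- (nu R d n / n%:R))
    * setnorm N (mxprods AA n) `^ n%:R^-1 <= jsr N AA
  /\ jsr N AA <= setnorm N (mxprods AA n) `^ n%:R^-1.
Proof.
split; last exact: jsr_le.
pose u m := setnorm N (mxprods AA m); set rho := jsr N AA.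
have rho0 : 0 < rho.
  by rewrite lt_neqAle eq_sym jsr_ge0// andbT; apply/eqP.
have d0 : (0 < d)%N by exact: ltnW.
have u1 : setnorm N AA = u 1%N by rewrite /u mxprods1.
have uD m l : u (m + l)%N <= u m * u l by exact: setnorm_mxprodsD.
(* Nonzero [rho] makes all the norms positive, so that their logarithms can be used. *)
have up m : (0 < m)%N -> 0 < u m.
  by move=> m0; apply: lt_le_trans (jsrX_le hN hS0 hSb m0); rewrite exprn_gt0.
have u0 : u 0%N = 1.
  apply/eqP; rewrite eq_le; apply/andP; split.
    apply: setnorm_le; first by exists 1%:M.
    by move=> _ ->; apply: opnorm_le => // v; rewrite mul1mx mul1r.
  by have := uD 0%N 1%N; rewrite add0n ler_pMl// up.
have {}up m : 0 < u m by case: m => [|m]; [rewrite u0|exact: up].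
pose L m := ln (u m) - m%:R * ln rho.
pose c := ln (C_const AA); have C1 := C_const_ge1 AA hd.
have C0 : 0 < C_const AA by exact: lt_le_trans C1.
have c0 : 0 <= c by exact: ln_ge0.
have L0 : L 0%N = 0 by rewrite /L u0 ln1 mul0r subr0.
have LD m l : L (m + l)%N <= L m + L l.
  have : ln (u (m + l)%N) <= ln (u m * u l) by rewrite ler_ln ?posrE ?mulr_gt0.
  by rewrite lnM ?posrE// /L natrD; lra.
have Lmul m : L (d * m)%N <= c + d.-1%:R * L m.
  have : ln (u (d * m)%N) <= ln (C_const AA * rho ^+ m * u m ^+ d.-1).
    rewrite ler_ln ?posrE ?mulr_gt0 ?exprn_gt0//; exact: bochi_jsr.
  rewrite !lnM ?posrE ?mulr_gt0 ?exprn_gt0// !lnXn// -/c /L natrM.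
  rewrite -[_ *+ m]mulr_natl -[_ *+ d.-1]mulr_natl.
  have -> : d%:R = d.-1%:R + 1 :> R by rewrite natr1 prednK.
  by lra.
have L1 : 0 <= L 1%N.
  rewrite /L mul1r subr_ge0 ler_ln ?posrE//.
  by have := jsrX_le hN hS0 hSb (ltn0Sn 0); rewrite expr1.
pose kappa := ln (u 1%N ^+ d / u d).
(* The multiples of [ln rho] cancel, so [kappa] is a defect of subadditivity. *)
have kE : kappa = d%:R * L 1%N - L d.
  rewrite /kappa ln_div ?posrE ?exprn_gt0// lnXn// -[_ *+ d]mulr_natl /L; ring.
have k0 : 0 <= kappa.
  by rewrite kE subr_ge0; exact: subadditive_le_mul.
have L1_le : L 1%N <= c + kappa.
  have := Lmul 1%N; rewrite muln1 kE.
  have -> : d%:R = d.-1%:R + 1 :> R by rewrite natr1 prednK.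
  by lra.
have /andP[_ hk] := trunc_log_bounds hd hn.
have H := digits_bound hd L0 LD Lmul L1 hk.
have hs := digit_sums_le_sigma R hd hn; have hv := digit_sum_le_nu R hd hn.
(* Inserting [L1_le] gives [c] the coefficient [f + g] and [kappa] the coefficient [g]; as [c] and
   [kappa] are nonnegative, [sigma] and [nu] may replace them. *)
have Ln : L n <= sigma R d n * c + nu R d n * kappa.
  move: H hs hv; set f := \sum_(i < _) _; set g := \sum_(i < _.+1) _ => H hs hv.
  have g0 : 0 <= g by apply: sumr_ge0 => i _; rewrite exprn_ge0.
  have h1 := ler_wpM2l g0 L1_le; have h2 := ler_wpM2r c0 hs.
  have h3 := ler_wpM2r k0 hv.
  by lra.
have n0 : 0 < n%:R :> R by rewrite ltr0n.
(* Taking logarithms and multiplying by [n] turns the goal into [Ln]. *)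
rewrite u1 -/(u d) -/(u n) -ler_ln ?posrE ?mulr_gt0 ?powR_gt0 ?divr_gt0 ?exprn_gt0//.
rewrite !lnM ?posrE ?mulr_gt0 ?powR_gt0 ?divr_gt0 ?exprn_gt0//.
rewrite !ln_powR -/c -/kappa -(ler_pM2l n0).
rewrite [leLHS](_ : _ = ln (u n) - (sigma R d n * c + nu R d n * kappa)); last first.
  by field; exact: lt0r_neq0.
by move: Ln; rewrite /L; lra.
Qed.
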